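(* Let $e>1$ be an odd integer and let $\gamma$ be an $e$-core partition. Then, as formal power series in $x$, \begin{align*} \sum_{w\ge 0} N_e^\gamma(w)x^w &= \frac{1}{(1-x)^{(e-1)/2}};\\ \sum_{w\ge 0} M_e^\gamma(w)x^w &= \frac{1}{(1-x)^{(e+1)/2}};\\ \sum_{w\ge 0} Z_e^\gamma(w)x^w &= \frac{1}{(1+x)(1-x)^{(e+1)/2}};\\ \sum_{w\ge 0} T_e^\gamma(w)x^w &= \frac{1}{(1+x)(1-x)^{(e+3)/2}}. \end{align*} In particular, all four counting functions depend only on $e$ and $w$ and not on $\gamma$.
   Context: Write a partition as $\lambda=(\lambda_1\ge\lambda_2\ge\dots\ge\lambda_\ell>0)$, $|\lambda|=\sum\lambda_j$. The $e$-core of $\lambda$ is obtained by repeatedly removing rim hooks of length $e$ until none remain; an $e$-core partition is a partition equal to its own $e$-core. The $e$-weight of $\lambda$ is $(|\lambda|-|\gamma|)/e$, where $\gamma$ is its $e$-core. The odd sequence of $\lambda$ is the tuple $O(\lambda)=(n_0,n_1,\dots,n_{e-1})$ of non-negative integers, where $n_i$ is the number of parts $\lambda_j$ such that $\lambda_j$ is odd and $\lambda_j-j\equiv i\pmod e$. For $w\ge0$, let $S_e^\gamma(w)$ be the set of odd sequences of partitions with $e$-core $\gamma$ and $e$-weight $w$. Define - $T_e^\gamma(w)=|S_e^\gamma(w)|$; - $Z_e^\gamma(w)$ = the number of $(n_0,\dots,n_{e-1})\in S_e^\gamma(w)$ with $n_i=0$ for some $i$; - $M_e^\gamma(w)$ =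 the number of new odd sequences, i.e. those $\theta\in S_e^\gamma(w)$ with $\theta\notin S_e^\gamma(w')$ for all $0\le w'<w$; - $N_e^\gamma(w)$ = the number of new odd sequences in $S_e^\gamma(w)$ (in the sense just defined) that contain a zero entry. *)

(* Defs.v *)
From HB Require Import structures.
From mathcomp Require Import all_boot all_order all_algebra.
From mathcomp Require Import finmap.
From mathcomp Require Import boolp classical_sets functions cardinality.

Set Implicit Arguments.
Unset Strict Implicit.
Unset Printing Implicit Defensive.

Set Warnings "-redundant-canonical-projection".

Import GRing.Theory.

Local Open Scope ring_scope.

Record fps (R : Type) := Fps { fps_coef : nat -> R }.

Lemma fpsP (R : Type) (f g : fps R) : fps_coef f =1 fps_coef g <-> f = g.
Proof.
split=> [|-> //]; case: f g => f [g] /= fg.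
by congr Fps; apply: functional_extensionality_dep.
Qed.

HB.instance Definition _ (R : Type) := gen_eqMixin (fps R).
HB.instance Definition _ (R : Type) := gen_choiceMixin (fps R).

Section FpsRing.
Variable R : comNzRingType.
Implicit Types f g h : fps R.

Definition fps_zero : fps R := Fps (fun=> 0).
Definition fps_opp f : fps R := Fps (fun n => - fps_coef f n).
Definition fps_add f g : fps R := Fps (fun n => fps_coef f n + fps_coef g n).
Definition fps_one : fps R := Fps (fun n => (n == 0)%N%:R).
Definition fps_mul f g : fps R :=
  Fps (fun n => \sum_(i < n.+1) fps_coef f i * fps_coef g (n - i)).
Definition fpsX : fps R := Fps (fun n => (n == 1)%N%:R).

Fact fps_addA : associative fps_add.
Proof. by move=> f g h; apply/fpsP => n; rewrite /= addrA. Qed.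
Fact fps_addC : commutative fps_add.
Proof. by move=> f g; apply/fpsP => n; rewrite /= addrC. Qed.
Fact fps_add0 : left_id fps_zero fps_add.
Proof. by move=> f; apply/fpsP => n; rewrite /= add0r. Qed.
Fact fps_addN : left_inverse fps_zero fps_opp fps_add.
Proof. by move=> f; apply/fpsP => n; rewrite /= addNr. Qed.

HB.instance Definition _ :=
  GRing.isZmodule.Build (fps R) fps_addA fps_addC fps_add0 fps_addN.

Definition fps_trunc N f : {poly R} := \poly_(i < N.+1) fps_coef f i.

Lemma coef_fps_trunc N f n : (n <= N)%N -> (fps_trunc N f)`_n = fps_coef f n.
Proof. by move=> nN; rewrite coef_poly ltnS nN. Qed.

Lemma coef_fps_mul_trunc N f g n : (n <= N)%N ->
  (fps_trunc N f * fps_trunc N g)`_n = fps_coef (fps_mul f g) n.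
Proof.
move=> nN; rewrite coefM; apply: eq_bigr => i _.
by rewrite !coef_fps_trunc // (leq_trans _ nN) ?leq_subr // -ltnS.
Qed.

Fact fps_mulC : commutative fps_mul.
Proof.
by move=> f g; apply/fpsP => n; rewrite -!(@coef_fps_mul_trunc n) // mulrC.
Qed.

Fact fps_mulA : associative fps_mul.
Proof.
move=> f g h; apply/fpsP => n.
transitivity ((fps_trunc n f * (fps_trunc n g * fps_trunc n h))`_n).
  rewrite coefM; apply: eq_bigr => i _.
  by rewrite coef_fps_trunc -1?ltnS // coef_fps_mul_trunc // leq_subr.
rewrite mulrA coefM; apply: eq_bigr => i _.
by rewrite coef_fps_mul_trunc -1?ltnS // coef_fps_trunc // leq_subr.
Qed.

Fact fps_mul1 : left_id fps_one fps_mul.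
Proof.
move=> f; apply/fpsP => n /=.
by rewrite big_ord_recl big1 ?addr0 /= ?mul1r ?subn0 // => i _; rewrite mul0r.
Qed.

Fact fps_mulDl : left_distributive fps_mul fps_add.
Proof.
move=> f g h; apply/fpsP => n /=.
by rewrite -big_split; apply: eq_bigr => i _; rewrite /= mulrDl.
Qed.

Fact fps_one_neq0 : fps_one != 0.
Proof. by apply/eqP => /fpsP /(_ 0%N) /= /eqP; rewrite oner_eq0. Qed.

HB.instance Definition _ := GRing.Zmodule_isComNzRing.Build (fps R)
  fps_mulA fps_mulC fps_mul1 fps_mulDl fps_one_neq0.

Definition fps_unit : {pred fps R} := fun f => `[< exists g, g * f = 1 >].

Definition fps_inv f : fps R :=
  if pselect (exists g, g * f = 1) is left ex then projT1 (cid ex) else f.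

Fact fps_mulV : {in fps_unit, left_inverse 1 fps_inv *%R}.
Proof.
move=> f /asboolP fU; rewrite /fps_inv; case: pselect => // ex.
exact: projT2 (cid ex).
Qed.

Fact fps_unitPl f g : g * f = 1 -> fps_unit f.
Proof. by move=> gf; apply/asboolP; exists g. Qed.

Fact fps_inv_out : {in [predC fps_unit], fps_inv =1 id}.
Proof.
move=> f /negP fU; rewrite /fps_inv; case: pselect => // ex.
by case: fU; apply/asboolP.
Qed.

HB.instance Definition _ := GRing.ComNzRing_hasMulInverse.Build (fps R)
  fps_mulV fps_unitPl fps_inv_out.

Lemma fps_coefXM f n :
  fps_coef (fpsX * f) n = if n is m.+1 then fps_coef f m else 0.
Proof.
case: n => [|n] /=; first by rewrite big_ord1 mul0r.
rewrite !big_ord_recl /= mul0r add0r mul1r subSS subn0.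
by rewrite big1 ?addr0 // => i _; rewrite mul0r.
Qed.

Lemma unit_fps_1subX : (1 - fpsX) \is a GRing.unit.
Proof.
apply/unitrPr; exists (Fps (fun=> 1)); apply/fpsP => n.
rewrite mulrBl mul1r.
change (1 - fps_coef (fpsX * Fps (fun=> 1)) n = (n == 0)%N%:R).
by rewrite fps_coefXM; case: n => [|n]; rewrite ?subr0 ?subrr.
Qed.

Lemma unit_fps_1addX : (1 + fpsX) \is a GRing.unit.
Proof.
apply/unitrPr; exists (Fps (fun n => (-1) ^+ n)); apply/fpsP => n.
rewrite mulrDl mul1r.
change ((-1) ^+ n + fps_coef (fpsX * Fps (fun n => (-1) ^+ n)) n
        = (n == 0)%N%:R).
by rewrite fps_coefXM; case: n => [|n]; rewrite ?addr0 // exprS mulN1r addNr.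
Qed.

End FpsRing.

Arguments fpsX {R}.

Definition genfun (a : nat -> nat) : fps int := Fps (fun w => (a w)%:Z).

Local Close Scope ring_scope.

Local Open Scope nat_scope.

Definition is_partition (lam : seq nat) : bool :=
  sorted geq lam && (0 \notin lam).

(* Cells are (row, column), both numbered from 0. *)
Definition in_diagram (lam : seq nat) (c : nat * nat) : bool :=
  c.2 < nth 0 lam c.1.

Definition in_skew (lam mu : seq nat) (c : nat * nat) : bool :=
  in_diagram lam c && ~~ in_diagram mu c.

Definition adjacent (c d : nat * nat) : bool :=
  [|| (c.1 == d.1) && (c.2.+1 == d.2), (c.1 == d.1) && (d.2.+1 == c.2),
      (c.2 == d.2) && (c.1.+1 == d.1) | (c.2 == d.2) && (d.1.+1 == c.1)].

Definition skew_connected (lam mu : seq nat) : Prop :=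
  forall c d, in_skew lam mu c -> in_skew lam mu d ->
    exists2 p, path [rel x y | adjacent x y && in_skew lam mu y] c p
             & last c p = d.

Definition skew_no_square (lam mu : seq nat) : Prop :=
  forall i j, ~~ [&& in_skew lam mu (i, j), in_skew lam mu (i, j.+1),
                     in_skew lam mu (i.+1, j) & in_skew lam mu (i.+1, j.+1)].

(* mu is obtained from lam by removing a rim hook of length e, that is, a
   connected skew diagram lam / mu with e cells and no 2 x 2 square. *)
Definition rim_hook_removal (e : nat) (lam mu : seq nat) : Prop :=
  [/\ is_partition mu, (forall i, nth 0 mu i <= nth 0 lam i),
      sumn lam = sumn mu + e, skew_connected lam mu & skew_no_square lam mu].

(* A relation, so that uniqueness of the core is not presupposed. *)
Inductive has_core (e : nat) : seq nat -> seq nat -> Prop :=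
| CoreDone lam of (forall mu, ~ rim_hook_removal e lam mu) :
    has_core e lam lam
| CoreStep lam mu gam of rim_hook_removal e lam mu & has_core e mu gam :
    has_core e lam gam.

Definition is_core_partition (e : nat) (gam : seq nat) : Prop :=
  is_partition gam /\ has_core e gam gam.

(* The row with index j : 'I_(size lam) holds the part lambda_(j + 1). *)
Definition odd_sequence (e : nat) (lam : seq nat) : e.-tuple nat :=
  [tuple #|[set j : 'I_(size lam) | odd (nth 0 lam j)
             && ((nth 0%N lam j)%:Z - (j.+1)%:Z == (i : nat)%:Z %[mod e%:Z])%Z]| | i < e].

Local Open Scope classical_set_scope.

Definition oddseqs (e : nat) (gam : seq nat) (w : nat) : set (e.-tuple nat) :=
  [set theta | exists lam, [/\ is_partition lam, has_core e lam gam,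
     (sumn lam - sumn gam) %/ e = w & theta = odd_sequence e lam]].
Arguments oddseqs : clear implicits.

Definition new_oddseqs (e : nat) (gam : seq nat) (w : nat) :
    set (e.-tuple nat) :=
  [set theta | oddseqs e gam w theta
             /\ forall w', w' < w -> ~ oddseqs e gam w' theta].
Arguments new_oddseqs : clear implicits.

Definition has_zero_entry (e : nat) : set (e.-tuple nat) :=
  [set theta | 0 \in theta].
Arguments has_zero_entry : clear implicits.

Local Open Scope fset_scope.

(* [fset_set] is meaningful on finite sets only: see [finite_oddseqs] below. *)
Definition Tcount (e : nat) (gam : seq nat) (w : nat) : nat :=
  #|` fset_set (oddseqs e gam w) |.

Definition Zcount (e : nat) (gam : seq nat) (w : nat) : nat :=
  #|` fset_set (oddseqs e gam w `&` has_zero_entry e)%classic |.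

Definition Mcount (e : nat) (gam : seq nat) (w : nat) : nat :=
  #|` fset_set (new_oddseqs e gam w) |.

Definition Ncount (e : nat) (gam : seq nat) (w : nat) : nat :=
  #|` fset_set (new_oddseqs e gam w `&` has_zero_entry e)%classic |.

Local Close Scope fset_scope.

Lemma size_le_sumn (s : seq nat) : 0 \notin s -> size s <= sumn s.
Proof.
elim: s => //= x s IHs; rewrite inE negb_or eq_sym -lt0n => /andP[x0 /IHs].
by rewrite -add1n; apply: leq_add.
Qed.

Lemma finite_partitions_le (n : nat) :
  finite_set [set lam | is_partition lam /\ sumn lam <= n].
Proof.
pose F (t : n.-bseq 'I_n.+1) : seq nat := map val t.
apply: (@sub_finite_set _ _ (F @` setT)); last first.
  exact: finite_image (@finite_finset _ _).
move=> lam [/andP[_ lam0] lam_n] /=.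
have lamB x : x \in lam -> x < n.+1.
  move=> xlam; rewrite ltnS; apply: leq_trans lam_n.
  by rewrite sumnE (big_rem x) //= leq_addr.
have sz : size (map (@inord n) lam) <= n.
  by rewrite size_map (leq_trans (size_le_sumn lam0)).
exists (Bseq sz) => //; rewrite /F /= -map_comp -[RHS]map_id.
by apply/eq_in_map => x /lamB xn; rewrite /= inordK.
Qed.

Lemma finite_oddseqs (e : nat) (gam : seq nat) (w : nat) :
  0 < e -> finite_set (oddseqs e gam w).
Proof.
move=> e0; pose n := (sumn gam + w.+1 * e)%N.
apply: (@sub_finite_set _ _
  (odd_sequence e @` [set lam | is_partition lam /\ sumn lam <= n])).
  move=> _ [lam [lamP _ defw ->]]; exists lam => //; split=> //.
  rewrite -leq_subLR -defw ltnW //; exact: ltn_ceil.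
exact/finite_image/finite_partitions_le.
Qed.

(* Main.v *)
Require Import Defs.
From mathcomp Require Import all_boot all_order all_algebra.
From mathcomp Require Import finmap zify.
From mathcomp Require Import boolp classical_sets functions cardinality.

(* Encode a partition by the beads [lambda_j - j] on an [e]-runner abacus: the
   part attached to a bead is the number of gaps below it, the [e]-core is given
   by the numbers [c_i] of beads on the runners, and the [e]-weight by the sum of
   the levels of the beads.  So one must count the odd sequences of bead
   configurations with prescribed counts [c] and weight [w].

   The count does not depend on [c].  To exchange the counts of two neighbouring
   runners, re-orient the pairs of neighbouring positions holding one bead: no
   part outside these pairs changes, and the two entries [n_r], [n_(r+1)] of the
   odd sequence can be changed so that their minimum is kept and their difference
   is shifted by a constant.  This is a bijection on odd sequences that preserves
   the weight and the presence of a zero entry.  Together with the rotation of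
   the abacus it connects all [c].

   For widely separated runners, the odd sequence is determined by [(e + 1) / 2]
   natural numbers of sum at most [w] and congruent to [w] modulo 2, which are
   arbitrary, and it has a zero entry exactly when the first of them is zero.
   This gives [T] and [Z].  Adding [2e] to the first part shows that the odd
   sequences of weight [w] persist in weight [w + 2], and an odd sequence
   determines the parity of the weight; hence [M = (1 - x^2) T] and
   [N = (1 - x^2) Z]. *)

Set Implicit Arguments.
Unset Strict Implicit.
Unset Printing Implicit Defensive.

Import GRing.Theory.

Local Open Scope nat_scope.

(** * Bead configurations on the abacus *)

Definition gaps (b : nat -> bool) (z : nat) : nat := \sum_(y < z) ~~ b y.

Definition beads (b : nat -> bool) (z : nat) : nat := \sum_(y < z) b y.

Lemma gapsS b z : gaps b z.+1 = gaps b z + ~~ b z.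
Proof. by rewrite /gaps big_ord_recr. Qed.

Lemma beadsS b z : beads b z.+1 = beads b z + b z.
Proof. by rewrite /beads big_ord_recr. Qed.

Lemma gaps_beads b z : gaps b z + beads b z = z.
Proof.
elim: z => [|z IHz]; first by rewrite /gaps /beads !big_ord0.
by rewrite gapsS beadsS; case: (b z) => /=; lia.
Qed.

Lemma eq_gaps b b' z : (forall y, y < z -> b y = b' y) -> gaps b z = gaps b' z.
Proof. by move=> eq_b; apply: eq_bigr => y _; rewrite eq_b. Qed.

Lemma eq_beads b b' z :
  (forall y, y < z -> b y = b' y) -> beads b z = beads b' z.
Proof. by move=> eq_b; apply: eq_bigr => y _; rewrite eq_b. Qed.

Lemma beads_le b y z : y <= z -> beads b y <= beads b z.
Proof.
move=> le_yz; rewrite -(subnKC le_yz); elim: (z - y) => [|k IHk].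
  by rewrite addn0.
by rewrite addnS beadsS; lia.
Qed.

Lemma gaps_le b y z : y <= z -> gaps b y <= gaps b z.
Proof.
move=> le_yz; rewrite -(subnKC le_yz); elim: (z - y) => [|k IHk].
  by rewrite addn0.
by rewrite addnS gapsS; lia.
Qed.

Lemma beads_lt_size b y z : y < z -> ~~ b y -> beads b z < z.
Proof.
move=> lt_yz bN; have := gaps_beads b z; have := gaps_le b lt_yz.
by rewrite gapsS bN; lia.
Qed.

(* The size of the partition whose parts are attached to the beads of [a]. *)
Definition excess (a : nat -> bool) (n : nat) : nat := \sum_(y < n) a y * gaps a y.

(** The position of a bead is the number of gaps below it plus the number of beads below it, and the
    latter takes the values 0, 1, 2, ... from one bead to the next. *)
Lemma sum_beads_excess (a : nat -> bool) n :
  \sum_(y < n) y * a y = 'C(beads a n, 2) + excess a n.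
Proof.
elim: n => [|n IHn]; first by rewrite /beads /excess !big_ord0.
rewrite /excess !big_ord_recr /= IHn beadsS -/(excess a n).
have := gaps_beads a n.
by case: (a n); rewrite /= ?addn1 ?addn0 ?binS ?bin1; lia.
Qed.

(** At most [y] beads lie below the gap; each of the others has it among the gaps below. *)
Lemma excess_gap (a : nat -> bool) n y :
  y < n -> ~~ a y -> beads a n - y <= excess a n.
Proof.
move=> lt_yn aN; suff [k ->] : exists k, n = y.+1 + k.
  elim: k {lt_yn} => [|k IHk].
    have := beads_lt_size (ltnSn y) aN.
    by rewrite addn0; lia.
  rewrite addnS beadsS /excess big_ord_recr /= -/(excess a _).
  have : gaps a y.+1 <= gaps a (y.+1 + k) by apply: gaps_le; lia.
  by rewrite gapsS aN; case: (a (y.+1 + k)) => /=; lia.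
by exists (n - y.+1); lia.
Qed.

Lemma excess_bead (a : nat -> bool) n y :
  y < n -> a y -> y.+1 - beads a n <= excess a n.
Proof.
move=> lt_yn ay; have leb : beads a y.+1 <= beads a n by apply: beads_le.
rewrite /excess (bigD1 (Ordinal lt_yn)) //= ay mul1n.
by have := gaps_beads a y; move: leb; rewrite beadsS ay; lia.
Qed.

(** Double count of the pairs of a bead and a gap, according to which of the two is lower. *)
Lemma excess_dual (a : nat -> bool) n :
  excess a n + \sum_(y < n) ~~ a y * beads a y = beads a n * gaps a n.
Proof.
elim: n => [|n IHn]; first by rewrite /excess /beads !big_ord0.
rewrite /excess !big_ord_recr /= -/(excess a n) beadsS gapsS.
by move: (bigop _ _ _) IHn => S; case: (a n); rewrite /= ?addn0 ?addn1 ?mulSn ?mulnS !mul0n; lia.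
Qed.

(* Position [q * e + i] is level [q] of runner [i] of the [e]-abacus. *)
Definition beadcount (e : nat) (b : nat -> bool) (Q i : nat) : nat :=
  \sum_(q < Q) b (q * e + i).

Definition oddcount (e : nat) (b : nat -> bool) (Q i : nat) : nat :=
  \sum_(q < Q) (b (q * e + i) && odd (gaps b (q * e + i))).

Definition height (e : nat) (b : nat -> bool) (Q : nat) : nat :=
  \sum_(i < e) \sum_(q < Q) q * b (q * e + i).

(* ['C(c_i, 2)] is the sum of the levels of [c_i] beads pushed down, so [w] is
   the weight. *)
Record abacus (e : nat) (c : seq nat) (w : nat) (b : nat -> bool) (Q : nat) :
    Prop := Abacus {
  abacus_supp : forall z, Q * e <= z -> b z = false;
  abacus_count : forall i, i < e -> beadcount e b Q i = nth 0 c i;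
  abacus_height : height e b Q = w + \sum_(i < e) 'C(nth 0 c i, 2) }.

Lemma select_count (P : nat -> bool) Q k :
  k <= \sum_(q < Q) P q -> exists R : nat -> bool, \sum_(q < Q) (P q && R q) = k.
Proof.
move=> le_k; exists (fun q => \sum_(q' < q) P q' < k).
have -> : \sum_(q < Q) (P q && (\sum_(q' < q) P q' < k))
          = minn k (\sum_(q < Q) P q).
  elim: Q {le_k} => [|Q IHQ]; first by rewrite !big_ord0 minn0.
  by rewrite !big_ord_recr /= IHQ; case: (P Q) => /=; lia.
exact/minn_idPl.
Qed.

(** * Exchange of two neighbouring runners *)

Section Swap.

Variables (e r : nat) (b : nat -> bool) (R : nat -> bool).
Hypothesis r_lt : r.+1 < e.

Let low q := b (q * e + r).
Let high q := b (q * e + r.+1).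

(** Only the rows with a single bead on runners [r] and [r.+1] change; [R q] tells whether that bead
    of row [q] goes to runner [r]. *)
Definition reorient (z : nat) : bool :=
  let q := z %/ e in
  if low q == high q then b z else
  if z %% e == r then R q else if z %% e == r.+1 then ~~ R q else b z.

Lemma reorientE q k : k < e -> reorient (q * e + k) =
  if low q == high q then b (q * e + k) else
  if k == r then R q else if k == r.+1 then ~~ R q else b (q * e + k).
Proof.
move=> k_lt; rewrite /reorient modnMDl modn_small // divnMDl; last by lia.
by rewrite divn_small // addn0.
Qed.

Lemma gaps_reorient q k : k < e -> k != r.+1 ->
  gaps reorient (q * e + k) = gaps b (q * e + k).
Proof.
(* The induction runs through all positions, so it needs a correction in the middle of a pair, where
   the two counts may differ by the position just passed. *)
suff H z : gaps reorient z + (if z %% e == r.+1 then ~~ b z.-1 : nat else 0)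
         = gaps b z + (if z %% e == r.+1 then ~~ reorient z.-1 : nat else 0).
  move=> k_lt /negbTE kr; have := H (q * e + k).
  by rewrite modnMDl modn_small // kr !addn0.
move=> {q k}; elim: z => [|z]; first by rewrite /gaps !big_ord0 mod0n.
have e_gt0 : 0 < e by lia.
rewrite !gapsS (divn_eq z e) modnMDl (modn_small (ltn_pmod z e_gt0)).
move: (z %/ e) (ltn_pmod z e_gt0) => q; move: (z %% e) => k k_lt {z}.
rewrite /= reorientE // -addnS modnMDl.
have [kr | kr] := eqVneq k r.
  rewrite kr (ltn_eqF (ltnSn r)) modn_small // eqxx /low /high addnS.
  by case: ifP => _; lia.
have [kr1 | kr1] := eqVneq k r.+1.
  have -> : (k.+1 %% e == r.+1) = false.
    rewrite kr1; have [<-|] := eqVneq r.+2 e; first by rewrite modnn.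
    by move=> ne; rewrite modn_small; lia.
  rewrite kr1 addnS /= reorientE ?eqxx; last by lia.
  rewrite /low /high addnS.
  by case: (b _); case: (b _); case: (R q) => /=; lia.
have -> : (k.+1 %% e == r.+1) = false.
  have [<-|ne] := eqVneq k.+1 e; first by rewrite modnn.
  by rewrite modn_small ?eqSS; lia.
by rewrite if_same; lia.
Qed.

End Swap.

Lemma beads_level e b q k :
  beads b (q * e + k) = beads b (q * e) + \sum_(i < k) b (q * e + i).
Proof.
elim: k => [|k IHk]; first by rewrite big_ord0 !addn0.
by rewrite addnS beadsS IHk big_ord_recr /= addnA.
Qed.

(** Only the number of beads in each row matters, so the height is unaffected by moving beads inside
    rows. *)
Lemma heightE e b Q :
  height e b Q = \sum_(q < Q) q * (beads b (q.+1 * e) - beads b (q * e)).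
Proof.
rewrite /height exchange_big; apply: eq_bigr => q _.
by rewrite -big_distrr mulSn addnC beads_level addKn.
Qed.

(* Keeps the minimum of [n r] and [n r.+1], and adds [y - x] to
   [n r - n r.+1]. *)
Definition swap_odd (r x y : nat) (n : nat -> nat) (i : nat) : nat :=
  if i == r then minn (n r) (n r.+1) + ((n r + y) - (n r.+1 + x))
  else if i == r.+1 then minn (n r) (n r.+1) + ((n r.+1 + x) - (n r + y))
  else n i.

(** Re-orientation leaves the parity of the gaps before each pair unchanged. A single bead on runner
    [r] has an odd part when this parity is odd, one on runner [r.+1] when it is even. Choosing how
    many single beads of either parity go to runner [r] therefore controls both the bead counts and
    the odd counts. *)
Lemma abacus_swap e s1 x y s2 w b Q :
    size (s1 ++ x :: y :: s2) = e -> abacus e (s1 ++ x :: y :: s2) w b Q ->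
  exists2 b', abacus e (s1 ++ y :: x :: s2) w b' Q &
    forall i, i < e ->
      oddcount e b' Q i = swap_odd (size s1) x y (oddcount e b Q) i.
Proof.
move=> size_s [supp_b cnt_b ht_b]; set r := size s1.
have r_lt : r.+1 < e by rewrite -size_s size_cat /= /r; lia.
have r_lt' : r < e by lia.
pose l q := b (q * e + r); pose h q := b (q * e + r.+1).
pose P q := odd (gaps b (q * e + r)).
(* Rows are classified as holding a bead on the lower runner only ([U]), on the upper one only ([V])
   or on both ([D]), with index 1 when [P] holds and 0 otherwise. *)
pose U1 := \sum_(q < Q) [&& l q, ~~ h q & P q].
pose U0 := \sum_(q < Q) [&& l q, ~~ h q & ~~ P q].
pose V1 := \sum_(q < Q) [&& ~~ l q, h q & P q].
pose V0 := \sum_(q < Q) [&& ~~ l q, h q & ~~ P q].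
pose D1 := \sum_(q < Q) [&& l q, h q & P q].
pose D0 := \sum_(q < Q) [&& l q, h q & ~~ P q].
have nth_r : nth 0 (s1 ++ x :: y :: s2) r = x.
  by rewrite nth_cat ltnn subnn.
have nth_r1 : nth 0 (s1 ++ x :: y :: s2) r.+1 = y.
  by rewrite nth_cat ltnNge leqnSn /= subSnn.
have nth_r' : nth 0 (s1 ++ y :: x :: s2) r = y.
  by rewrite nth_cat ltnn subnn.
have nth_r1' : nth 0 (s1 ++ y :: x :: s2) r.+1 = x.
  by rewrite nth_cat ltnNge leqnSn /= subSnn.
have nth_i i : i != r -> i != r.+1 ->
  nth 0 (s1 ++ y :: x :: s2) i = nth 0 (s1 ++ x :: y :: s2) i.
  rewrite !nth_cat /r; case: ltnP => // le_i; case def_i: (i - size s1) => [|[|k]] //=; lia.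
have Ex : x = U1 + U0 + D1 + D0.
  rewrite -nth_r -cnt_b // /beadcount -!big_split; apply: eq_bigr => q _ /=.
  by rewrite -/(l q); case: (l q); case: (h q); case: (P q).
have Ey : y = V1 + V0 + D1 + D0.
  rewrite -nth_r1 -cnt_b // /beadcount -!big_split; apply: eq_bigr => q _ /=.
  by rewrite -/(h q); case: (l q); case: (h q); case: (P q).
have En : oddcount e b Q r = U1 + D1.
  rewrite /oddcount -!big_split; apply: eq_bigr => q _ /=.
  by rewrite -/(l q) -/(P q); case: (l q); case: (h q); case: (P q).
have En1 : oddcount e b Q r.+1 = V0 + D1.
  rewrite /oddcount -!big_split; apply: eq_bigr => q _ /=.
  rewrite -/(h q) addnS gapsS oddD oddb -/(l q) -/(P q).
  by case: (l q); case: (h q); case: (P q).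
pose single q := l q != h q.
have Ek1 : \sum_(q < Q) (single q && P q) = U1 + V1.
  rewrite -!big_split; apply: eq_bigr => q _ /=.
  by rewrite /single; case: (l q); case: (h q); case: (P q).
have Ek0 : \sum_(q < Q) (single q && ~~ P q) = U0 + V0.
  rewrite -!big_split; apply: eq_bigr => q _ /=.
  by rewrite /single; case: (l q); case: (h q); case: (P q).
(* The odd counts are [U1 + D1] and [V0 + D1]. Keeping their minimum and replacing the difference
   [U1 - V0] by [V1 - U0], which is larger by [y - x], prescribes these two numbers of beads on the
   lower runner. *)
have [|R1 Er1] := @select_count (fun q => single q && P q) Q
  (minn U1 V0 + (V1 - U0)); first by lia.
have [|R0 Er0] := @select_count (fun q => single q && ~~ P q) Q
  (U0 + V0 - (minn U1 V0 + (U0 - V1))); first by lia.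
pose R q := if P q then R1 q else R0 q.
pose b' := reorient e r b R.
have b'E q k : k < e -> b' (q * e + k) = if l q == h q then b (q * e + k)
    else if k == r then R q else if k == r.+1 then ~~ R q else b (q * e + k).
  exact: reorientE.
have b'r q : b' (q * e + r) = if l q == h q then l q else R q.
  by rewrite b'E // eqxx.
have b'r1 q : b' (q * e + r.+1) = if l q == h q then h q else ~~ R q.
  by rewrite b'E // eqxx (gtn_eqF (ltnSn r)).
have b'i q i : i < e -> i != r -> i != r.+1 -> b' (q * e + i) = b (q * e + i).
  by move=> ie /negbTE ir /negbTE ir1; rewrite b'E // ir ir1 if_same.
have gap_r q : gaps b' (q * e + r) = gaps b (q * e + r).
  by rewrite gaps_reorient //; lia.
have Ex' : beadcount e b' Q r = y.
  suff: beadcount e b' Q r = minn U1 V0 + (V1 - U0)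
      + (U0 + V0 - (minn U1 V0 + (U0 - V1))) + D1 + D0 by lia.
  rewrite -Er1 -Er0 -!big_split; apply: eq_bigr => q _ /=.
  rewrite b'r /R /single.
  by case: (l q); case: (h q); case: (P q); case: (R1 q); case: (R0 q).
have Ey' : beadcount e b' Q r.+1 = x.
  suff: beadcount e b' Q r.+1 + beadcount e b' Q r
        = U1 + U0 + V1 + V0 + D1 + D0 + D1 + D0 by lia.
  rewrite -!big_split; apply: eq_bigr => q _ /=.
  rewrite b'r b'r1.
  by case: (l q); case: (h q); case: (P q); case: (R q).
have En' : oddcount e b' Q r = minn U1 V0 + (V1 - U0) + D1.
  rewrite -Er1 -!big_split; apply: eq_bigr => q _ /=.
  rewrite b'r /R /single gap_r -/(P q).
  by case: (l q); case: (h q); case: (P q); case: (R1 q); case: (R0 q).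
have En1' : oddcount e b' Q r.+1 = minn U1 V0 + (U0 - V1) + D1.
  suff: oddcount e b' Q r.+1 + (U0 + V0 - (minn U1 V0 + (U0 - V1)))
        = U0 + V0 + D1 by lia.
  rewrite -Er0 -!big_split; apply: eq_bigr => q _ /=.
  rewrite b'r1 addnS gapsS gap_r oddD oddb -/(P q) b'r /R /single.
  by case: (l q); case: (h q); case: (P q); case: (R1 q); case: (R0 q).
exists b'; first split.
- move=> z le_z; rewrite (divn_eq z e).
  have z_lt : z %% e < e by rewrite ltn_pmod; lia.
  have le_Q : Q * e <= z %/ e * e by rewrite leq_mul2r leq_divRL ?le_z ?orbT; lia.
  have b0 i : b (z %/ e * e + i) = false by apply: supp_b; lia.
  by rewrite b'E // /l /h !b0 eqxx.
- move=> i i_lt; have [-> | ir] := eqVneq i r; first by rewrite nth_r'.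
  have [-> | ir1] := eqVneq i r.+1; first by rewrite nth_r1'.
  by rewrite nth_i // -cnt_b //; apply: eq_bigr => q _; rewrite b'i.
- transitivity (height e b Q).
    have beadsE q : beads b' (q * e) = beads b (q * e).
      have := gaps_beads b (q * e); have := gaps_beads b' (q * e).
      rewrite -[q * e]addn0 (@gaps_reorient e r b R r_lt) //; last by lia.
      by rewrite /b'; lia.
    by rewrite !heightE; apply: eq_bigr => q _; rewrite !beadsE.
  rewrite ht_b; congr (_ + _).
  pose i0 := Ordinal r_lt'; pose i1 := Ordinal r_lt.
  have i10 : i1 != i0 by rewrite -val_eqE /=; lia.
  rewrite [LHS](bigD1 i0) // [RHS](bigD1 i0) //=.
  rewrite [X in _ + X = _](bigD1 i1) // [X in _ = _ + X](bigD1 i1) //=.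
  rewrite nth_r nth_r' nth_r1 nth_r1' addnCA.
  do 2![congr (_ + _)]; apply: eq_bigr => i /andP[].
  by rewrite -!val_eqE /= => ir ir1; rewrite nth_i.
- move=> i i_lt; rewrite /swap_odd.
  have [-> | ir] := eqVneq i r; first by rewrite En' En En1; lia.
  have [-> | ir1] := eqVneq i r.+1; first by rewrite En1' En En1; lia.
  apply: eq_bigr => q _; rewrite b'i //.
  by rewrite gaps_reorient //; lia.
Qed.

(** * Rotation of the abacus *)

Section Rotation.

Variables (e : nat) (b b' : nat -> bool) (Q : nat).
Hypotheses (b'0 : b' 0) (b'S : forall z, b' z.+1 = b z).
Hypothesis supp_b' : forall z, Q * e.+1 <= z -> b' z = false.

Lemma gaps_rot z : gaps b' z.+1 = gaps b z.
Proof.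
rewrite /gaps big_ord_recl b'0 add0n.
by apply: eq_bigr => y _; rewrite b'S.
Qed.

Lemma sum_shift (F : nat -> nat) : F Q = 0 ->
  \sum_(q < Q) F q = F 0 + \sum_(q < Q) F q.+1.
Proof.
move=> FQ; transitivity (\sum_(q < Q.+1) F q); last by rewrite big_ord_recl.
by rewrite big_ord_recr /= FQ addn0.
Qed.

Let last_pos q : q.+1 * e.+1 + 0 = (q * e.+1 + e).+1.
Proof. by rewrite mulSn; lia. Qed.

Let b'Q : b' (Q * e.+1 + 0) = false.
Proof. by rewrite addn0 supp_b'. Qed.

Lemma beadcount_rot0 : beadcount e.+1 b' Q 0 = (beadcount e.+1 b Q e).+1.
Proof.
rewrite /beadcount (sum_shift (F := fun q => b' (q * e.+1 + 0))) ?b'Q //=.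
by rewrite mul0n b'0; congr _.+1; apply: eq_bigr => q _; rewrite last_pos b'S.
Qed.

Lemma beadcount_rotS i : beadcount e.+1 b' Q i.+1 = beadcount e.+1 b Q i.
Proof. by apply: eq_bigr => q _; rewrite addnS b'S. Qed.

(** The new bead at position 0 has no gap below it, so its part is 0, which is even. *)
Lemma oddcount_rot0 : oddcount e.+1 b' Q 0 = oddcount e.+1 b Q e.
Proof.
rewrite /oddcount (sum_shift
  (F := fun q => b' (q * e.+1 + 0) && odd (gaps b' (q * e.+1 + 0)))) ?b'Q //=.
rewrite mul0n {1}/gaps big_ord0 andbF; apply: eq_bigr => q _.
by rewrite last_pos b'S gaps_rot.
Qed.

Lemma oddcount_rotS i : oddcount e.+1 b' Q i.+1 = oddcount e.+1 b Q i.
Proof. by apply: eq_bigr => q _; rewrite addnS b'S gaps_rot. Qed.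

(** The beads of the last runner wrap around to runner 0, one level higher; all others keep their
    level. *)
Lemma height_rot :
  height e.+1 b' Q = height e.+1 b Q + beadcount e.+1 b Q e.
Proof.
rewrite /height big_ord_recl [in RHS]big_ord_recr /= addnC -addnA.
congr (_ + _).
  by apply: eq_bigr => i _; apply: eq_bigr => q _; rewrite /bump addnS b'S.
rewrite (sum_shift (F := fun q => q * b' (q * e.+1 + 0))) ?b'Q ?muln0 //=.
rewrite mul0n add0n -big_split; apply: eq_bigr => q _ /=.
by rewrite last_pos b'S mulSn addnC.
Qed.

(** The height grows by [x], and so does the height of the flush configuration, since
    ['C(x.+1, 2) = 'C(x, 2) + x]; hence the weight is the same. *)
Lemma abacus_rot s x w : size s = e ->
  abacus e.+1 (rcons s x) w b Q <-> abacus e.+1 (x.+1 :: s) w b' Q.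
Proof.
move=> size_s; have cnt i : i < e.+1 -> (beadcount e.+1 b Q i = nth 0 (rcons s x) i)
    <-> (beadcount e.+1 b' Q (if i == e then 0 else i.+1)
         = nth 0 (x.+1 :: s) (if i == e then 0 else i.+1)).
  rewrite nth_rcons size_s => i_lt; case: eqP => [-> | ie].
    by rewrite ltnn beadcount_rot0 /=; split=> [-> | []].
  by rewrite beadcount_rotS /= ifT //; lia.
have binE : \sum_(i < e.+1) 'C(nth 0 (x.+1 :: s) i, 2)
            = \sum_(i < e.+1) 'C(nth 0 (rcons s x) i, 2) + x.
  rewrite big_ord_recl [in RHS]big_ord_recr /= nth_rcons size_s ltnn eqxx.
  rewrite binS bin1 [LHS]addnC addnA; congr (_ + _ + _).
  by apply: eq_bigr => i _; rewrite nth_rcons size_s ltn_ord.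
have nth_last : nth 0 (rcons s x) e = x by rewrite nth_rcons size_s ltnn eqxx.
split=> -[supp cnt_b ht_b]; split.
- by [].
- move=> [|i] i_lt; first by have [+ _] := cnt e (ltnSn e); rewrite eqxx; apply; apply: cnt_b.
  have [+ _] := cnt i (ltnW i_lt); rewrite ifF; last by lia.
  by apply; apply: cnt_b; lia.
- by rewrite height_rot binE ht_b cnt_b // nth_last addnA.
- by move=> z le_z; rewrite -b'S supp_b' //; lia.
- move=> i i_lt; apply/cnt => //; apply: cnt_b; case: ifP; lia.
- have cnt_e : beadcount e.+1 b Q e = x.
    by rewrite -nth_last; apply/cnt => //; apply: cnt_b; case: ifP; lia.
  by move: ht_b; rewrite height_rot binE cnt_e; lia.
Qed.

End Rotation.

(** * Change of the cutoff level and bounds from the weight *)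

Lemma abacus_resize e c w b Q Q' : (forall z, Q' * e <= z -> b z = false) ->
    abacus e c w b Q ->
  abacus e c w b Q' /\ (forall i, oddcount e b Q' i = oddcount e b Q i).
Proof.
move=> supp' [supp cnt ht].
have b0 q i : minn Q Q' <= q -> b (q * e + i) = false.
  rewrite geq_min => /orP[] le_q; [apply: supp|apply: supp'].
    by rewrite (leq_trans (n := q * e)) ?leq_addr ?leq_mul2r ?le_q ?orbT.
  by rewrite (leq_trans (n := q * e)) ?leq_addr ?leq_mul2r ?le_q ?orbT.
have sum_min (F : nat -> nat) m n : m <= n -> (forall q, m <= q -> F q = 0) ->
    \sum_(q < n) F q = \sum_(q < m) F q.
  move=> le_mn F0; rewrite -(subnKC le_mn); elim: (n - m) => [|k IHk].
    by rewrite addn0.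
  by rewrite addnS big_ord_recr /= IHk F0 ?addn0 ?leq_addr.
have sumE (F : nat -> nat) : (forall q, minn Q Q' <= q -> F q = 0) ->
    \sum_(q < Q') F q = \sum_(q < Q) F q.
  by move=> F0; rewrite !(sum_min F (minn Q Q')) ?geq_minl ?geq_minr.
split; last first.
  move=> i; pose F q := b (q * e + i) && odd (gaps b (q * e + i)).
  by apply: (sumE F) => q le_q; rewrite /F b0.
split=> //.
- move=> i i_lt; rewrite -cnt //.
  by apply: (sumE (fun q => b (q * e + i))) => q /b0->.
- rewrite -ht; apply: eq_bigr => i _.
  by apply: (sumE (fun q => q * b (q * e + i))) => q /b0->; rewrite muln0.
Qed.

Lemma abacus_widen e c w b Q Q' : Q <= Q' ->
    abacus e c w b Q ->
  abacus e c w b Q' /\ (forall i, oddcount e b Q' i = oddcount e b Q i).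
Proof.
move=> le_Q ab; apply: (abacus_resize _ ab) => z le_z.
by apply: (abacus_supp ab); apply: leq_trans le_z; rewrite leq_mul2r le_Q orbT.
Qed.

(** The excess of a runner is the size of the corresponding component of the [e]-quotient. *)
Lemma runner_excess e c w b Q : abacus e c w b Q ->
  \sum_(i < e) excess (fun q => b (q * e + i)) Q = w.
Proof.
case=> supp cnt ht; move: ht; rewrite /height.
have -> : \sum_(i < e) \sum_(q < Q) q * b (q * e + i)
    = \sum_(i < e) 'C(nth 0 c i, 2)
      + \sum_(i < e) excess (fun q => b (q * e + i)) Q.
  rewrite -big_split; apply: eq_bigr => i _.
  by rewrite (sum_beads_excess (fun q => b (q * e + i))) -cnt.
by lia.
Qed.

Lemma abacus_gap e c w b Q q i : abacus e c w b Q -> i < e ->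
  ~~ b (q * e + i) -> nth 0 c i <= q + w.
Proof.
(* The cutoff is raised above [q], since the gap may lie beyond level [Q]. *)
move=> ab i_lt bN; have [ab' _] := abacus_widen (leq_addr q.+1 Q) ab.
have := runner_excess ab'; rewrite (bigD1 (Ordinal i_lt)) //=.
rewrite -(abacus_count ab' i_lt).
have := @excess_gap (fun q => b (q * e + i)) (Q + q.+1) q _ bN.
rewrite /beadcount /beads; lia.
Qed.

Lemma abacus_bead e c w b Q q i : abacus e c w b Q -> i < e ->
  b (q * e + i) -> q < nth 0 c i + w.
Proof.
move=> ab i_lt bq; have [ab' _] := abacus_widen (leq_addr q.+1 Q) ab.
have := runner_excess ab'; rewrite (bigD1 (Ordinal i_lt)) //=.
rewrite -(abacus_count ab' i_lt).
have := @excess_bead (fun q => b (q * e + i)) (Q + q.+1) q _ bq.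
rewrite /beadcount /beads; lia.
Qed.

(** * Independence of the core *)

Local Open Scope classical_set_scope.
Local Open Scope card_scope.

(** The flag [z] imposes a zero entry, so that the counts [T] and [Z] are treated together. *)
Definition absets (e : nat) (c : seq nat) (w : nat) (z : bool) :
    set (e.-tuple nat) :=
  [set theta : e.-tuple nat | (z -> 0 \in theta) /\ exists b Q,
     abacus e c w b Q /\
     forall i, i < e -> nth 0 theta i = oddcount e b Q i].
Arguments absets : clear implicits.

Lemma card_le_inj T U (A : set T) (B : set U) (f : T -> U) :
  injective f -> (forall x, A x -> B (f x)) -> A #<= B.
Proof.
move=> f_inj fAB; rewrite -(card_le_eql (inj_card_eq (in2W f_inj))).
by apply: subset_card_le => _ [x Ax <-]; apply: fAB.
Qed.

Lemma nth_mktuple_nat e (f : nat -> nat) i :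
  i < e -> nth 0 [tuple f i | i < e] i = f i.
Proof. by move=> i_lt; rewrite -(tnth_nth 0 _ (Ordinal i_lt)) tnth_mktuple. Qed.

Lemma tuple_memP e (theta : e.-tuple nat) v :
  reflect (exists2 i, i < e & nth 0 theta i = v) (v \in theta).
Proof. by apply: (iffP (nthP 0)); rewrite size_tuple. Qed.

Lemma tuple_nth_inj e (theta eta : e.-tuple nat) :
  (forall i, i < e -> nth 0 theta i = nth 0 eta i) -> theta = eta.
Proof.
move=> eq_nth; apply: val_inj; apply: (@eq_from_nth _ 0); rewrite !size_tuple //.
Qed.

(** A pair of numbers is determined by its minimum and its difference; the first is kept and the
    second is shifted by a constant. *)
Lemma swap_odd_inj e r x y (theta eta : e.-tuple nat) : r.+1 < e ->
  (forall i, i < e ->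
     swap_odd r x y (nth 0 theta) i = swap_odd r x y (nth 0 eta) i) ->
  theta = eta.
Proof.
move=> r_lt eq_swap; have r_lt' : r < e by lia.
have := eq_swap _ r_lt; have := eq_swap _ r_lt'.
rewrite /swap_odd eqxx (gtn_eqF (ltnSn r)) eqxx => eq_r eq_r1.
apply: tuple_nth_inj => i i_lt.
have [-> | ir] := eqVneq i r; first by lia.
have [-> | ir1] := eqVneq i r.+1; first by lia.
by have := eq_swap _ i_lt; rewrite /swap_odd (negbTE ir) (negbTE ir1).
Qed.

(** If the zero is one of the two changed entries, their minimum is zero, and one of the new entries
    equals this minimum. *)
Lemma swap_odd_mem0 e r x y (theta : e.-tuple nat) : r.+1 < e ->
  0 \in theta -> 0 \in [tuple swap_odd r x y (nth 0 theta) i | i < e].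
Proof.
move=> r_lt /tuple_memP[i i_lt th_i]; apply/tuple_memP.
have r_lt' : r < e by lia.
have sw_i := nth_mktuple_nat (swap_odd r x y (nth 0 theta)).
have [ir | ir] := boolP ((i == r) || (i == r.+1)); last first.
  exists i; rewrite // sw_i // /swap_odd.
  by move: ir; rewrite negb_or => /andP[/negbTE-> /negbTE->].
have m0 : minn (nth 0 theta r) (nth 0 theta r.+1) = 0.
  by case/orP: ir => /eqP ir; rewrite -ir th_i; lia.
have [le_ | lt_] := leqP (nth 0 theta r + y) (nth 0 theta r.+1 + x).
  by exists r; rewrite // sw_i // /swap_odd eqxx m0; lia.
exists r.+1; rewrite // sw_i // /swap_odd eqxx (gtn_eqF (ltnSn r)) m0; lia.
Qed.

(** [swap_odd] gives an injection in either direction; Cantor-Bernstein then yields equal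
    cardinals. *)
Lemma card_absets_swap e s1 x y s2 w z : size (s1 ++ x :: y :: s2) = e ->
  absets e (s1 ++ x :: y :: s2) w z #= absets e (s1 ++ y :: x :: s2) w z.
Proof.
suff le_swap x' y' : size (s1 ++ x' :: y' :: s2) = e ->
    absets e (s1 ++ x' :: y' :: s2) w z #<= absets e (s1 ++ y' :: x' :: s2) w z.
  move=> size_s; rewrite card_eq_le !le_swap //.
  by move: size_s; rewrite !size_cat.
move=> {x y} size_s; have r_lt : (size s1).+1 < e.
  by rewrite -size_s size_cat /=; lia.
apply: (@card_le_inj _ _ _ _
  (fun th : e.-tuple nat => [tuple swap_odd (size s1) x' y' (nth 0 th) i | i < e])).
  move=> th eta eq_sw; apply: (@swap_odd_inj e (size s1) x' y') => // i i_lt.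
  by rewrite -!(nth_mktuple_nat (swap_odd _ _ _ _) i_lt) eq_sw.
move=> th [z0 [b [Q [ab odd_b]]]]; split=> [/z0|]; first exact: swap_odd_mem0.
have [b' ab' odd_b'] := abacus_swap size_s ab.
exists b', Q; split=> // i i_lt.
rewrite odd_b' // nth_mktuple_nat // /swap_odd !odd_b //; lia.
Qed.

(** Rotation permutes the odd sequence cyclically. It can be undone if position 0 holds a bead,
    which the bound on [w] guarantees. *)
Lemma card_absets_rot e s x w z : size s = e -> w < x.+1 ->
  absets e.+1 (rcons s x) w z #= absets e.+1 (x.+1 :: s) w z.
Proof.
move=> size_s lt_wx; rewrite card_eq_le; apply/andP; split.
  pose F (th : seq nat) i := if i is j.+1 then nth 0 th j else nth 0 th e.
  pose f (th : e.+1.-tuple nat) := [tuple F th i | i < e.+1].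
  have fE th i : i < e.+1 ->
      nth 0 (f th) i = if i is j.+1 then nth 0 th j else nth 0 th e.
    by move=> i_lt; rewrite (nth_mktuple_nat (F th)).
  apply: (@card_le_inj _ _ _ _ f).
    move=> th eta eq_f; apply: tuple_nth_inj => i i_lt.
    pose j := if i == e then 0 else i.+1.
    have j_lt : j < e.+1 by rewrite /j; case: eqP; lia.
    by have := fE th j j_lt; rewrite eq_f fE // /j; case: eqP => [->|].
  move=> th [z0 [b [Q [ab odd_b]]]]; split=> [/z0|].
    move=> /tuple_memP[i i_lt th_i]; apply/tuple_memP.
    exists (if i == e then 0 else i.+1); first by case: eqP; lia.
    by case: eqP th_i => [-> | ie] th_i; rewrite fE //; lia.
  pose b' y := if y is y'.+1 then b y' else true.
  (* The extra level makes room for a bead that wraps around from the top level of the last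
     runner. *)
  have [ab1 odd1] := abacus_widen (leqnSn Q) ab.
  have supp y : Q.+1 * e.+1 <= y -> b' y = false.
    case: y => [|y] le_y /=; first by lia.
    by apply: (abacus_supp ab); lia.
  have b'S y : b' y.+1 = b y by [].
  exists b', Q.+1; split; first exact/(abacus_rot _ b'S supp).
  case=> [|i] i_lt; rewrite fE // odd_b ?odd1 //.
    by rewrite (oddcount_rot0 _ b'S) // odd1.
    by rewrite (@oddcount_rotS _ b b') // odd1.
  exact: ltnW.
pose G (th : seq nat) i := if i == e then nth 0 th 0 else nth 0 th i.+1.
pose f (th : e.+1.-tuple nat) := [tuple G th i | i < e.+1].
have fE th i : i < e.+1 ->
    nth 0 (f th) i = if i == e then nth 0 th 0 else nth 0 th i.+1.
  by move=> i_lt; rewrite (nth_mktuple_nat (G th)).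
apply: (@card_le_inj _ _ _ _ f).
  move=> th eta eq_f; apply: tuple_nth_inj => -[|i] i_lt.
    by have := fE th e; rewrite eq_f fE // eqxx => ->.
  have := fE th i; rewrite eq_f fE; last by lia.
  by rewrite ltn_eqF // => ->; lia.
move=> th [z0 [b' [Q [ab odd_b]]]]; split=> [/z0|].
  move=> /tuple_memP[[|i] i_lt th_i]; apply/tuple_memP.
    by exists e; rewrite // fE // eqxx.
  by exists i; rewrite ?fE; try lia; rewrite ltn_eqF.
(* A gap at position 0 would raise all [x.+1] beads of runner 0, at a cost exceeding [w]. *)
have b'0 : b' 0.
  have := @abacus_gap _ _ _ _ _ 0 0 ab isT.
  by case: (b' 0) => // /(_ isT) /=; lia.
pose b y := b' y.+1; have b'S y : b' y.+1 = b y by [].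
have supp := abacus_supp ab.
exists b, Q; split; first exact/(abacus_rot b'0 b'S supp).
move=> i i_lt; rewrite fE //; case: eqP => [-> | ie].
  by rewrite odd_b // (oddcount_rot0 b'0 b'S).
by rewrite odd_b; [rewrite (@oddcount_rotS _ b b') | lia].
Qed.

Lemma card_absets_bubble e s1 x s2 w z : size (s1 ++ x :: s2) = e ->
  absets e (s1 ++ x :: s2) w z #= absets e (rcons (s1 ++ s2) x) w z.
Proof.
elim: s2 s1 => [|y s2 IHs] s1 size_s; first by rewrite cats0 cats1 card_eqxx.
apply: card_eq_trans (card_absets_swap w z size_s) _.
rewrite -cat_rcons -[in X in _ #= X]cat_rcons; apply: IHs.
by move: size_s; rewrite !size_cat /= size_rcons; lia.
Qed.

(** Exchanges bring [x] to the end, the rotation turns it into [x.+1] at the front, and exchanges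
    bring this back to the place of [x], passing through the end again. *)
Lemma card_absets_succ e s1 x s2 w z : size (s1 ++ x :: s2) = e -> w <= x ->
  absets e (s1 ++ x :: s2) w z #= absets e (s1 ++ x.+1 :: s2) w z.
Proof.
case: e => [|e] size_s le_w; first by move: size_s; rewrite size_cat /=; lia.
have size_e : size (s1 ++ s2) = e by move: size_s; rewrite !size_cat /=; lia.
apply: card_eq_trans (card_absets_bubble w z size_s) _.
apply: card_eq_trans (card_absets_rot z size_e _) _; first by lia.
have bub s : size (s ++ s2) = e ->
    absets e.+1 (x.+1 :: s ++ s2) w z #= absets e.+1 (s ++ x.+1 :: s2) w z.
  move=> size_s'; rewrite (card_eql (@card_absets_bubble e.+1 [::] _ _ w z _)) /= ?size_s' //.
  rewrite card_eq_sym; apply: card_absets_bubble.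
  by move: size_s'; rewrite !size_cat /=; lia.
exact: bub.
Qed.

(** The entries are replaced one at a time: [x] and [x'] can both be raised to [x + x']. *)
Lemma card_absets_indep e s s' w z : size s = e -> size s' = e ->
  all (leq w) s -> all (leq w) s' -> absets e s w z #= absets e s' w z.
Proof.
have le1 s1 x k s2 : size (s1 ++ x :: s2) = e -> w <= x ->
    absets e (s1 ++ x :: s2) w z #= absets e (s1 ++ x + k :: s2) w z.
  move=> size_s le_w; elim: k => [|k IHk]; first by rewrite addn0 card_eqxx.
  rewrite addnS; apply: card_eq_trans IHk _; apply: card_absets_succ.
    by rewrite -size_s !size_cat.
  by rewrite (leq_trans le_w) ?leq_addr.
rewrite -[s]cat0s -[s']cat0s; move: [::] => p.
elim: s s' p => [|x s IHs] [|x' s'] p.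
- by rewrite card_eqxx.
- by move=> <-; rewrite !size_cat /=; lia.
- by move=> <-; rewrite !size_cat /=; lia.
move=> size_s size_s'; rewrite !all_cat /= => /and3P[wp wx ws] /and3P[_ wx' ws'].
apply: (@card_eq_trans _ _ _ _ (absets e (p ++ x' :: s) w z)).
  apply: card_eq_trans (le1 p x x' s size_s wx) _.
  rewrite addnC card_eq_sym; apply: le1 => //.
  by rewrite -size_s !size_cat.
rewrite -!cat_rcons; apply: IHs; rewrite cat_rcons ?all_cat /= ?wp ?wx' //.
by rewrite -size_s !size_cat.
Qed.

(** * Well separated runners *)

Lemma gaps_cat f m n : gaps f (m + n) = gaps f m + gaps (fun y => f (m + y)) n.
Proof. by rewrite /gaps big_split_ord. Qed.

Lemma beads_cat f m n :
  beads f (m + n) = beads f m + beads (fun y => f (m + y)) n.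
Proof. by rewrite /beads big_split_ord. Qed.

Lemma sum_blocks (F : nat -> nat) n k :
  \sum_(q < n * k) F q = \sum_(j < n) \sum_(y < k) F (j * k + y).
Proof.
elim: n => [|n IHn]; first by rewrite mul0n !big_ord0.
by rewrite mulSn addnC big_split_ord big_ord_recr /= IHn.
Qed.

Lemma sum_odd_le (f : nat -> bool) (g : nat -> nat) n :
  \sum_(y < n) (f y && odd (g y)) <= \sum_(y < n) f y * g y.
Proof. by apply: leq_sum => y _; case: (f y); case: (g y) => //= k; case: odd. Qed.

Lemma sum_odd_odd (f : nat -> bool) (g : nat -> nat) n :
  odd (\sum_(y < n) (f y && odd (g y))) = odd (\sum_(y < n) f y * g y).
Proof.
elim: n => [|n IHn]; first by rewrite !big_ord0.
by rewrite !big_ord_recr /= !oddD IHn; case: (f n); rewrite ?mul1n ?oddb.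
Qed.

(** Every other bead, starting with the lowest, has an even number of beads below it. *)
Lemma sum_even_beads (a : nat -> bool) n :
  \sum_(y < n) (a y && ~~ odd (beads a y)) = uphalf (beads a n).
Proof.
elim: n => [|n IHn]; first by rewrite /beads !big_ord0.
rewrite big_ord_recr /= IHn beadsS.
by case: (a n) => /=; [case: odd (uphalf_half (beads a n)); lia | lia].
Qed.

Lemma sum_even_gaps (a : nat -> bool) n :
  \sum_(y < n) (~~ a y && ~~ odd (gaps a y)) = uphalf (gaps a n).
Proof.
elim: n => [|n IHn]; first by rewrite /gaps !big_ord0.
rewrite big_ord_recr /= IHn gapsS.
by case: (a n) => /=; [lia | case: odd (uphalf_half (gaps a n)); lia].
Qed.

(** The excess also sums, over the gaps, the number of beads above. As the total is even, a gap with
    an odd number of beads below has at least one above. *)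
Lemma sum_odd_gap_beads_le (a : nat -> bool) n : ~~ odd (beads a n) ->
  \sum_(y < n) (~~ a y && odd (beads a y)) <= excess a n.
Proof.
move=> evB; rewrite -(leq_add2r (\sum_(y < n) ~~ a y * beads a y)).
rewrite excess_dual /gaps big_distrr -big_split /=; apply: leq_sum => y _ /=.
have := beads_le a (ltnW (ltn_ord y)); case: (a y) => //=.
rewrite mul1n muln1 leq_eqVlt => /orP[/eqP-> | lt_B]; last by case: odd; lia.
by rewrite (negbTE evB).
Qed.

Lemma sum_odd_gap_beads_odd (a : nat -> bool) n : ~~ odd (beads a n) ->
  odd (\sum_(y < n) (~~ a y && odd (beads a y))) = odd (excess a n).
Proof.
move=> evB; rewrite (sum_odd_odd (fun y => ~~ a y) (beads a)).
have /(congr1 odd) := excess_dual a n.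
by rewrite oddD oddM (negbTE evB); case: odd; case: odd.
Qed.

(* In the configurations considered below, runner [j] has beads on all levels
   below [j * 4v] and none from level [(j + 1) * 4v] on. *)
Definition rock_window (e v : nat) (b : nat -> bool) (j y : nat) : bool :=
  b ((j * v.*2.*2 + y) * e + j).

Section Rock.

Variables (e v : nat) (b : nat -> bool).
Let W := v.*2.
Let L := W.*2.
Local Notation a := (rock_window e v b).
Hypothesis b_low : forall q k, k < e -> q < k * L -> b (q * e + k).
Hypothesis b_high : forall q k, k < e -> k.+1 * L <= q -> ~~ b (q * e + k).

Let runner_split k : k < e -> e * L = k * L + (L + (e - k.+1) * L).
Proof. by move=> k_lt; rewrite -mulSn -mulnDl; congr (_ * _); lia. Qed.

Lemma rock_gaps_low k q : k < e -> q <= k * L ->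
  gaps (fun q => b (q * e + k)) q = 0.
Proof.
move=> k_lt le_q; rewrite /gaps big1 // => y _.
by rewrite b_low //; apply: leq_trans le_q.
Qed.

Lemma rock_beadcount k :
  k < e -> beadcount e b (e * L) k = k * L + beads (a k) L.
Proof.
move=> k_lt; rewrite /beadcount -/(beads (fun q => b (q * e + k)) (e * L)).
rewrite (runner_split k_lt) !beads_cat.
have := gaps_beads (fun q => b (q * e + k)) (k * L).
rewrite rock_gaps_low // add0n => ->.
rewrite [X in _ + (_ + X)]/beads big1 ?addn0 // => y _.
by rewrite (negbTE (b_high _ _)) //; lia.
Qed.

Lemma rock_excess k : k < e ->
  excess (fun q => b (q * e + k)) (e * L) = excess (a k) L.
Proof.
move=> k_lt; rewrite (runner_split k_lt) /excess !big_split_ord /=.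
rewrite big1 ?add0n => [|y _]; last by rewrite rock_gaps_low ?muln0 ?(ltnW (ltn_ord y)).
rewrite [X in _ + X]big1 ?addn0 => [|y _].
  by apply: eq_bigr => y _; rewrite gaps_cat rock_gaps_low.
by rewrite (negbTE (b_high _ _)) //; lia.
Qed.

(** On the levels of window [j], later runners are full and earlier ones empty; only runner [j]
    varies. *)
Lemma rock_row j y i : j < e -> y < L -> i < e ->
  b ((j * L + y) * e + i) = (j < i) || ((i == j) && a j y).
Proof.
move=> j_lt y_lt i_lt; have [ji | ij | ->] := ltngtP j i.
- by apply: b_low => //; have := leq_mul2r L j.+1 i; rewrite ji orbT mulSn; lia.
- apply/negbTE/b_high => //.
  by have := leq_mul2r L i.+1 j; rewrite ij orbT; lia.
- by [].
Qed.

Lemma rock_gaps_row j y k : j < e -> y < L -> k <= e ->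
  gaps b ((j * L + y) * e + k)
  = gaps b ((j * L + y) * e) + minn k j + ((j < k) && ~~ a j y).
Proof.
move=> j_lt y_lt; elim: k => [|k IHk] k_lt; first by rewrite min0n !addn0.
rewrite addnS gapsS IHk; last by lia.
rewrite rock_row //; have [kj|jk|->] := ltngtP j k => /=.
- by rewrite (leq_trans kj) //; lia.
- by rewrite ltnNge jk /=; lia.
- by rewrite ltnSn /=; lia.
Qed.

Lemma rock_gaps_region j y : j < e -> y <= L ->
  gaps b ((j * L + y) * e) = gaps b (j * L * e) + y * j + gaps (a j) y.
Proof.
move=> j_lt; elim: y => [|y IHy] y_lt.
  by rewrite [gaps (a j) 0]big_ord0 !addn0.
rewrite addnS mulSn addnC rock_gaps_row // IHy; last by lia.
by rewrite j_lt gapsS (minn_idPr (ltnW j_lt)) mulSn; lia.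
Qed.

Hypothesis b_W : forall k, k < e -> beads (a k) L = W.

(** A complete window [j] contributes [L * j + W] gaps, which is even because [W = 2v] and [L = 4v]
    are. Parities can thus be computed inside one window. *)
Lemma rock_gaps_even j : j < e -> ~~ odd (gaps b (j * L * e)).
Proof.
elim: j => [|j IHj] j_lt; first by rewrite !mul0n /gaps big_ord0.
rewrite mulSn addnC rock_gaps_region //; try lia.
have := gaps_beads (a j) L; rewrite b_W; last by lia.
move=> EL; have -> : gaps (a j) L = W by rewrite /L in EL *; lia.
by rewrite !oddD (negbTE (IHj _)) ?oddM ?odd_double //; lia.
Qed.

Let p j y := odd (gaps b ((j * L + y) * e + j)).

(** In window [j] each row adds [j] gaps besides those of runner [j]. For odd [j] this adds [y + 1]
    modulo 2, which turns the gaps of the runner into its beads and flips the parity. *)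
Lemma rock_parity j y : j < e -> y < L ->
  p j y = if odd j then ~~ odd (beads (a j) y) else odd (gaps (a j) y).
Proof.
move=> j_lt y_lt; rewrite /p rock_gaps_row //; last by lia.
rewrite rock_gaps_region //; last by lia.
rewrite ltnn minnn addn0 !oddD (negbTE (rock_gaps_even _)) // oddM.
rewrite -{1}(gaps_beads (a j) y) oddD; case: (odd j) => //=.
  by case: odd; case: odd.
by rewrite andbF addbF.
Qed.

(* The parity data of runner [j] that survives in the odd sequence. *)
Definition rock_stat j : nat :=
  if odd j then \sum_(y < L) (~~ a j y && odd (beads (a j) y))
  else \sum_(y < L) (a j y && odd (gaps (a j) y)).

Lemma rock_stat_le j : j < e -> rock_stat j <= excess (a j) L.
Proof.
move=> j_lt; rewrite /rock_stat; case: (odd j); last exact: sum_odd_le.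
by apply: sum_odd_gap_beads_le; rewrite b_W // odd_double.
Qed.

Lemma rock_stat_odd j : j < e -> odd (rock_stat j) = odd (excess (a j) L).
Proof.
move=> j_lt; rewrite /rock_stat; case: (odd j); last exact: sum_odd_odd.
by apply: sum_odd_gap_beads_odd; rewrite b_W // odd_double.
Qed.

Let own j : j < e ->
  \sum_(y < L) (a j y && p j y) = if odd j then v else rock_stat j.
Proof.
move=> j_lt; rewrite /rock_stat.
transitivity (\sum_(y < L) (a j y &&
  if odd j then ~~ odd (beads (a j) y) else odd (gaps (a j) y))).
  by apply: eq_bigr => y _; rewrite rock_parity.
by case: (odd j); rewrite // sum_even_beads b_W // uphalf_double.
Qed.

(** The summand is the parity seen by the full runners beyond [j]: that of position [j] in the row,
    flipped if runner [j] has a gap there. Beads or gaps of alternating parity contribute [v], and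
    the rest is the statistic. *)
Let below j : j < e ->
  \sum_(y < L) (p j y (+) ~~ a j y) = rock_stat j + v.
Proof.
move=> j_lt; rewrite /rock_stat.
have EL := gaps_beads (a j) L; rewrite b_W // in EL.
have gapsL : gaps (a j) L = W by rewrite /L in EL *; lia.
transitivity (\sum_(y < L) ((if odd j then ~~ odd (beads (a j) y)
                             else odd (gaps (a j) y)) (+) ~~ a j y)).
  by apply: eq_bigr => y _; rewrite rock_parity.
case: (odd j).
  transitivity (\sum_(y < L) (~~ a j y && odd (beads (a j) y))
              + \sum_(y < L) (a j y && ~~ odd (beads (a j) y))).
    rewrite -big_split; apply: eq_bigr => y _ /=.
    by case: (a j y); case: odd.
  by rewrite sum_even_beads b_W // uphalf_double.
transitivity (\sum_(y < L) (a j y && odd (gaps (a j) y))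
            + \sum_(y < L) (~~ a j y && ~~ odd (gaps (a j) y))).
  rewrite -big_split; apply: eq_bigr => y _ /=.
  by case: (a j y); case: odd.
by rewrite sum_even_gaps gapsL uphalf_double.
Qed.

(** Runner [k] is full in the windows before its own, where [below] applies, and empty in the later
    ones. *)
Lemma rock_oddcount k : k < e -> oddcount e b (e * L) k =
  \sum_(j < k) (rock_stat j + v) + (if odd k then v else rock_stat k).
Proof.
move=> k_lt; rewrite /oddcount.
rewrite (sum_blocks (fun q => b (q * e + k) && odd (gaps b (q * e + k)))).
have [d De] : exists d, e = k + (1 + d) by exists (e - k.+1); lia.
pose F j := \sum_(y < L) (b ((j * L + y) * e + k)
                           && odd (gaps b ((j * L + y) * e + k))).
rewrite (_ : bigop _ _ _ = \sum_(j < k + (1 + d)) F j); last by rewrite -De.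
rewrite !big_split_ord big_ord1 /= addn0.
congr (_ + _).
  apply: eq_bigr => j _; have j_lt := ltn_ord j.
  rewrite -below; last by lia.
  rewrite /F; apply: eq_bigr => y _; rewrite rock_row //; try lia.
  rewrite j_lt /= /p !rock_gaps_row //; try lia.
rewrite big1 ?addn0 => [|i _].
  by rewrite -own //.
rewrite /F; apply: big1 => y _; have i_lt := ltn_ord i.
rewrite rock_row //; try lia.
Qed.

End Rock.

(** Runner [k] has [k] full windows of [4v] beads and [2v] beads in its own window. *)
Definition rock_counts (v e : nat) : seq nat :=
  mkseq (fun k => k.*2.+1 * v.*2) e.

Definition rock_theta (v : nat) (s : seq nat) (k : nat) : nat :=
  uphalf k * v.*2 + \sum_(i < k./2.+1) nth 0 s i.

Lemma sumn_mkseq (f : nat -> nat) n : sumn (mkseq f n) = \sum_(i < n) f i.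
Proof. by rewrite sumnE big_map -val_enum_ord big_map big_enum. Qed.

Lemma sum_pairs (r : nat -> nat) m :
  \sum_(j < m.*2.+1) r j
  = \sum_(i < m.+1) (if (i : nat) is i'.+1 then r i'.*2.+1 + r i'.*2.+2 else r 0).
Proof.
elim: m => [|m IHm]; first by rewrite !big_ord1.
by rewrite doubleS [LHS]big_ord_recr [in LHS]big_ord_recr /= IHm [RHS]big_ord_recr /= addnA.
Qed.

(** The statistic of an odd runner never appears without that of the next runner, so only the sums
    of these pairs and [r 0] matter. *)
Lemma rock_theta_stat v n (r : nat -> nat) (s : seq nat) k : k <= n.*2 ->
    (forall i, i <= n ->
       nth 0 s i = if i is i'.+1 then r i'.*2.+1 + r i'.*2.+2 else r 0) ->
  \sum_(j < k) (r j + v) + (if odd k then v else r k) = rock_theta v s k.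
Proof.
move=> k_le s_r; rewrite /rock_theta big_split /= sum_nat_const card_ord.
have -> : \sum_(i < k./2.+1) nth 0 s i = \sum_(j < k./2.*2.+1) r j.
  rewrite sum_pairs; apply: eq_bigr => i _; rewrite s_r //.
  by have := ltn_ord i; have := odd_double_half k; lia.
move: k_le => _; rewrite -(odd_double_half k).
case: (odd k); move: k./2 => m; rewrite ?add1n ?add0n /= odd_double /=.
  by rewrite uphalf_double doubleK; lia.
by rewrite uphalf_double doubleK big_ord_recr /=; lia.
Qed.

(** Weight below [2v] cannot create a gap below the window of a runner or a bead above it. Each
    statistic is at most the excess of its runner and congruent to it modulo 2, and the excesses add
    up to [w]. *)
Lemma rock_abacus_image v n w b Q : w < v.*2 ->
    abacus n.*2.+1 (rock_counts v n.*2.+1) w b Q ->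
  exists s, [/\ size s = n.+1, sumn s <= w, odd (sumn s) = odd w &
    forall k, k < n.*2.+1 -> oddcount n.*2.+1 b Q k = rock_theta v s k].
Proof.
set e := n.*2.+1 => w_lt ab; pose L := v.*2.*2.
have b_low q k : k < e -> q < k * L -> b (q * e + k).
  move=> k_lt q_lt; apply/negPn/negP => /(abacus_gap ab k_lt).
  by rewrite nth_mkseq // /L in q_lt *; lia.
have b_high q k : k < e -> k.+1 * L <= q -> ~~ b (q * e + k).
  move=> k_lt q_ge; apply/negP => /(abacus_bead ab k_lt).
  by rewrite nth_mkseq // /L in q_ge *; lia.
have supp z : e * L * e <= z -> b z = false.
  move=> le_z; rewrite (divn_eq z e); apply/negbTE/b_high; rewrite ?ltn_pmod //.
  apply: (leq_trans (n := e * L)); first by rewrite leq_mul2r ltn_pmod ?orbT.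
  by rewrite leq_divRL.
have [ab' odd_b] := abacus_resize supp ab.
have b_W k : k < e -> beads (rock_window e v b k) L = v.*2.
  move=> k_lt; have := abacus_count ab' k_lt.
  by rewrite (rock_beadcount b_low b_high) // nth_mkseq // -/L /L; lia.
have stat_le := rock_stat_le b_W; have stat_odd := rock_stat_odd b_W.
have exc := runner_excess ab'.
pose r := rock_stat e v b.
pose f i := if i is i'.+1 then r i'.*2.+1 + r i'.*2.+2 else r 0.
have sumE : sumn (mkseq f n.+1) = \sum_(j < e) r j.
  by rewrite sumn_mkseq /e sum_pairs.
exists (mkseq f n.+1); split.
- by rewrite size_mkseq.
- rewrite sumE -exc; apply: leq_sum => j _.
  by rewrite (rock_excess b_low b_high) // stat_le.
- rewrite sumE -exc; apply: (big_ind2 (fun x y => odd x = odd y)) => //.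
    by move=> x1 x2 y1 y2; rewrite !oddD => -> ->.
  by move=> j _; rewrite (rock_excess b_low b_high) // stat_odd.
- move=> k k_lt; rewrite -odd_b (rock_oddcount b_low b_high) //.
  by apply: (@rock_theta_stat v n r) => // i i_le; rewrite nth_mkseq.
Qed.

(* The runner of a partition with [m] parts 2, [t] parts 1 and, counting zeros,
   [W] parts. *)
Definition two_col (W m t y : nat) : bool :=
  [&& y < W.+2, y != W - m - t & y != W.+1 - m].

Section TwoColumns.

Variables (W m t : nat).
Hypothesis le_W : m + t <= W.

Local Notation a := (two_col W m t).

Lemma gaps_two_col y :
  y <= W.+2 -> gaps a y = (W - m - t < y) + (W.+1 - m < y).
Proof.
elim: y => [|y IHy] y_le; first by rewrite /gaps big_ord0.
by rewrite gapsS IHy ?(ltnW y_le) // /two_col y_le /=; do 2![case: eqP]; lia.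
Qed.

Lemma two_col_out y : W.+2 <= y -> a y = false.
Proof. by move=> le_y; rewrite /two_col ltnNge le_y. Qed.

Lemma sum_two_col (F : nat -> nat) n : W.+2 <= n ->
  \sum_(y < n) a y * F y = \sum_(y < W.+2) a y * F y.
Proof.
move=> le_n; rewrite -(subnKC le_n) big_split_ord /= [X in _ + X]big1 ?addn0 //.
by move=> i _; rewrite two_col_out // leq_addr.
Qed.

Lemma beads_two_col n : W.+2 <= n -> beads a n = W.
Proof.
move=> le_n; have := sum_two_col (fun=> 1) le_n.
have sum1 k : \sum_(y < k) a y * 1 = beads a k.
  by apply: eq_bigr => y _; rewrite muln1.
rewrite !sum1 => ->; have := gaps_beads a W.+2.
by rewrite gaps_two_col //; lia.
Qed.

Lemma excess_two_col n : W.+2 <= n -> excess a n = t + m.*2.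
Proof.
move=> le_n; rewrite /excess sum_two_col // -/(excess a _).
suff H y : y <= W.+2 -> excess a y =
    if y <= W.+1 - m then y - (W - m - t).+1
    else t + (y - (W.+2 - m)).*2 by rewrite H //; case: ifP; lia.
elim: y => [|y IHy] y_le; first by rewrite /excess big_ord0 leq0n sub0n.
rewrite /excess big_ord_recr /= -/(excess a y) IHy ?gaps_two_col; try lia.
by rewrite /two_col y_le /=; do 2![case: eqP]; repeat case: ifP; lia.
Qed.

Lemma odd_two_col n : W.+2 <= n ->
  \sum_(y < n) (a y && odd (gaps a y)) = t.
Proof.
move=> le_n.
have sumE k : \sum_(y < k) (a y && odd (gaps a y))
              = \sum_(y < k) a y * odd (gaps a y).
  by apply: eq_bigr => y _; rewrite mulnb.
rewrite sumE (sum_two_col (fun y => odd (gaps a y))) // -sumE.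
suff H y : y <= W.+2 -> \sum_(i < y) (a i && odd (gaps a i))
    = minn t (y - (W - m - t).+1) by rewrite H //; lia.
elim: y => [|y IHy] y_le; first by rewrite big_ord0; lia.
rewrite big_ord_recr /= IHy ?gaps_two_col; try lia.
by rewrite /two_col y_le /=; do 2![case: eqP]; do 2?[case: ltnP]; lia.
Qed.

End TwoColumns.

(** On a flush runner every gap has all [W] beads below it. *)
Lemma odd_gaps_flush W n : ~~ odd W ->
  \sum_(y < n) (~~ two_col W 0 0 y && odd (beads (two_col W 0 0) y)) = 0.
Proof.
move=> evW; have colE y : two_col W 0 0 y = (y < W).
  by rewrite /two_col; do 2![case: eqP]; lia.
have bE y : beads (two_col W 0 0) y = minn y W.
  elim: y => [|y IHy]; first by rewrite /beads big_ord0 min0n.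
  by rewrite beadsS IHy colE; lia.
apply: big1 => y _; rewrite colE bE -leqNgt.
by case: leqP; rewrite /= ?(negbTE evW).
Qed.

Lemma rock_abacus_exists v n w s : w < v -> size s = n.+1 ->
    sumn s <= w -> odd (sumn s) = odd w ->
  exists b Q, abacus n.*2.+1 (rock_counts v n.*2.+1) w b Q /\
    forall k, k < n.*2.+1 -> oddcount n.*2.+1 b Q k = rock_theta v s k.
Proof.
set e := n.*2.+1 => w_lt size_s s_le s_odd; pose W := v.*2; pose L := W.*2.
(* Entry [i] of [s] is realised by that many parts 1 on runner [2i]; odd runners stay flush. The
   remaining weight is even and is spent on parts 2 of runner 0, which are invisible in the odd
   sequence. *)
pose t k := if odd k then 0 else nth 0 s k./2.
pose m k := if k == 0 then (w - sumn s)./2 else 0.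
have sumE : sumn s = \sum_(k < e) t k.
  rewrite /e sum_pairs -[s in LHS](@mkseq_nth _ 0) size_s sumn_mkseq.
  apply: eq_bigr => -[[|i] i_lt] _ //=; rewrite /t /= odd_double /=.
  by rewrite doubleK.
have t_le k : k < e -> t k <= sumn s.
  by move=> k_lt; rewrite sumE (bigD1 (Ordinal k_lt)) //= leq_addr.
have mt k : k < e -> m k + t k <= W.
  by move=> /t_le; rewrite /m /W; case: eqP; lia.
have L_ge : W.+2 <= L by rewrite /L /W; lia.
pose a k := two_col W (m k) (t k).
pose b z := let k := z %% e in let q := z %/ e in
  if q < k * L then true else a k (q - k * L).
have bE q k : k < e -> b (q * e + k) = if q < k * L then true else a k (q - k * L).
  by move=> k_lt; rewrite /b modnMDl modn_small // divnMDl // divn_small // addn0.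
have b_low q k : k < e -> q < k * L -> b (q * e + k).
  by move=> k_lt q_lt; rewrite bE // q_lt.
have b_high q k : k < e -> k.+1 * L <= q -> ~~ b (q * e + k).
  by move=> k_lt q_ge; rewrite bE // ifF /a ?two_col_out //; lia.
have aE k : k < e -> rock_window e v b k =1 a k.
  by move=> k_lt y; rewrite /rock_window bE // -/W -/L ltnNge leq_addr addKn.
have eq_ga k y : k < e -> gaps (rock_window e v b k) y = gaps (a k) y.
  by move=> k_lt; apply: eq_gaps => i _; rewrite aE.
have eq_ba k y : k < e -> beads (rock_window e v b k) y = beads (a k) y.
  by move=> k_lt; apply: eq_beads => i _; rewrite aE.
have b_W k : k < e -> beads (rock_window e v b k) L = v.*2.
  by move=> k_lt; rewrite eq_ba // beads_two_col // mt.
have exc k : k < e -> excess (fun q => b (q * e + k)) (e * L) = t k + (m k).*2.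
  move=> k_lt; rewrite (rock_excess b_low b_high) //.
  rewrite -(@excess_two_col W (m k) (t k) (mt k k_lt) L) //.
  by apply: eq_bigr => y _; rewrite aE // eq_ga.
have stat k : k < e -> rock_stat e v b k = t k.
  move=> k_lt; rewrite /rock_stat -/W -/L.
  case: (boolP (odd k)) => k_odd.
    have [mk tk] : m k = 0 /\ t k = 0.
      by rewrite /m /t k_odd; split=> //; case: eqP k_odd => // ->.
    rewrite tk -[RHS](@odd_gaps_flush W L) ?odd_double //.
    by apply: eq_bigr => y _; rewrite aE // eq_ba // /a mk tk.
  rewrite -[RHS](@odd_two_col W (m k) (t k) (mt k k_lt) L) //.
  by apply: eq_bigr => y _; rewrite aE // eq_ga.
exists b, (e * L); split; first split.
- move=> z le_z; rewrite (divn_eq z e); apply/negbTE/b_high; rewrite ?ltn_pmod //.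
  apply: (leq_trans (n := e * L)); first by rewrite leq_mul2r ltn_pmod ?orbT.
  by rewrite leq_divRL.
- move=> k k_lt; rewrite (rock_beadcount b_low b_high) // b_W //.
  by rewrite nth_mkseq // /L /W; lia.
- transitivity (\sum_(k < e) ('C(nth 0 (rock_counts v e) k, 2)
                              + (t k + (m k).*2))).
    apply: eq_bigr => k _; rewrite (sum_beads_excess (fun q => b (q * e + k))).
    rewrite exc //; congr ('C(_, 2) + _); rewrite nth_mkseq //.
    transitivity (beadcount e b (e * L) k) => //.
    by rewrite (rock_beadcount b_low b_high) // b_W // /L /W; lia.
  rewrite big_split /= addnC; congr (_ + _); rewrite big_split /= -sumE.
  rewrite big_ord_recl big1 //= addn0 /m eqxx.
  by have := odd_double_half (w - sumn s); rewrite oddB // s_odd addbb; lia.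
- move=> k k_lt; rewrite (rock_oddcount b_low b_high) //.
  rewrite -(@rock_theta_stat v n t) // => [|i i_le].
    congr (_ + _); last by case: odd; rewrite ?stat.
    by apply: eq_bigr => j _; rewrite stat // (ltn_trans (ltn_ord j)).
  case: i i_le => [|i] _; rewrite /t //= odd_double /=.
  by rewrite doubleK.
Qed.

(** * Counting odd sequences *)

(** What remains of [w] after the [h] entries has to be even, which accounts for a factor
    [1 / (1 - x^2)] in the generating function. *)
Fixpoint comps (h w : nat) : seq (seq nat) :=
  if h is h'.+1 then
    flatten [seq map (cons x) (comps h' (w - x)) | x <- iota 0 w.+1]
  else if odd w then [::] else [:: [::]].

Lemma compsS h w : comps h.+1 w =
  flatten [seq map (cons x) (comps h (w - x)) | x <- iota 0 w.+1].
Proof. by []. Qed.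

Lemma mem_comps h w s :
  (s \in comps h w) = [&& size s == h, sumn s <= w & odd (sumn s) == odd w].
Proof.
elim: h w s => [|h IHh] w s.
  case: s => [|x s] /=; last by case: (odd w); rewrite !inE.
  by case: (odd w).
rewrite compsS; apply/flatten_mapP/idP => [[x] | ].
  rewrite mem_iota add0n => /andP[_ x_le] /mapP[t + ->] /=.
  rewrite IHh => /and3P[/eqP-> t_le /eqP t_odd].
  by rewrite eqxx oddD t_odd oddB //; case: (odd x); case: (odd w); lia.
case: s => [|x s] // /and3P[/eqP[size_s]].
rewrite -[sumn _]/(x + sumn s) => s_le /eqP s_odd.
exists x; first by rewrite mem_iota; lia.
apply: map_f; rewrite IHh size_s eqxx oddB ?(leq_trans _ s_le) ?leq_addr // -s_odd.
by rewrite oddD; case: (odd x); case: (odd (sumn s)); lia.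
Qed.

Lemma uniq_comps h w : uniq (comps h w).
Proof.
elim: h w => [|h IHh] w; first by rewrite /=; case: odd.
rewrite compsS; apply: (@allpairs_uniq_dep _ _ _ cons _ (fun x => comps h (w - x))).
- exact: iota_uniq.
- by move=> x _; apply: IHh.
- by move=> [x s] [y t] _ _ /= [-> ->].
Qed.

Lemma size_comps0 w : size (comps 0 w) = ~~ odd w.
Proof. by rewrite /=; case: odd. Qed.

Lemma size_compsS h w :
  size (comps h.+1 w) = \sum_(x < w.+1) size (comps h (w - x)).
Proof.
rewrite compsS size_flatten sumnE /shape -map_comp big_map -val_enum_ord.
by rewrite big_map big_enum; apply: eq_bigr => x _; rewrite /= size_map.
Qed.

Lemma card_set_seq (T : choiceType) (A : set T) (l : seq T) :
  uniq l -> (forall x, A x <-> x \in l) -> A #= `I_(size l).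
Proof.
move=> l_uniq A_l; rewrite (_ : A = [set` [fset x in l]%fset]%classic).
  by apply/card_eq_fsetP; rewrite card_fseq undup_id.
by apply/seteqP; split=> x /=; rewrite in_fset_ => /A_l.
Qed.

(** The entries of even index give all partial sums of [s], up to known constants. *)
Lemma rock_theta_inj v n (s t : seq nat) : size s = n.+1 -> size t = n.+1 ->
  (forall k, k < n.*2.+1 -> rock_theta v s k = rock_theta v t k) -> s = t.
Proof.
move=> size_s size_t eq_th; have eq_sum m : m <= n ->
    \sum_(i < m.+1) nth 0 s i = \sum_(i < m.+1) nth 0 t i.
  move=> m_le; have := eq_th m.*2; rewrite /rock_theta doubleK.
  by rewrite ltnS leq_double => /(_ m_le) /addnI.
apply: (@eq_from_nth _ 0); rewrite size_s ?size_t // => -[|i] i_lt.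
  by have := eq_sum 0 isT; rewrite !big_ord1.
have := eq_sum i.+1 i_lt; rewrite big_ord_recr [in RHS]big_ord_recr /=.
by rewrite eq_sum => [/addnI|]; last lia.
Qed.

(** Entries of positive index contain a positive multiple of [2v], so a zero entry means that [s]
    starts with 0; then only [n] numbers remain free. *)
Lemma card_absets_rock v n w z : w < v ->
  absets n.*2.+1 (rock_counts v n.*2.+1) w z
    #= `I_(size (comps (n + ~~ z) w)).
Proof.
set e := n.*2.+1 => w_lt.
pose l := if z then map (cons 0) (comps n w) else comps n.+1 w.
pose f (s : seq nat) : e.-tuple nat := [tuple rock_theta v s k | k < e].
have mem_l s : (s \in l) =
    [&& size s == n.+1, sumn s <= w, odd (sumn s) == odd w
      & z ==> (nth 0 s 0 == 0)].
  rewrite /l; case: (z); rewrite ?implyTb ?implyFb; last by rewrite mem_comps andbT.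
  apply/mapP/and4P => [[t + ->] | []].
    by rewrite mem_comps => /and3P[/eqP/= -> -> ->].
  case: s => [|x s] //= /eqP[size_s] + + /eqP x0; rewrite x0 add0n => s_le s_odd.
  by exists s; rewrite // mem_comps size_s eqxx s_le.
have l_uniq : uniq l.
  rewrite /l; case: (z); last exact: uniq_comps.
  by rewrite map_inj_uniq ?uniq_comps // => s t [].
have fE s k : k < e -> nth 0 (f s) k = rock_theta v s k.
  by move=> k_lt; rewrite (nth_mktuple_nat (rock_theta v s)).
have f_zero s : (0 \in f s) = (nth 0 s 0 == 0).
  apply/tuple_memP/eqP => [[[|k] k_lt] | s0].
  - by rewrite fE // /rock_theta /= mul0n big_ord1.
  - by rewrite fE // /rock_theta /=; lia.
  - by exists 0; rewrite // fE // /rock_theta /= mul0n big_ord1.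
have -> : size (comps (n + ~~ z) w) = size (map f l).
  by rewrite size_map /l; case: (z); rewrite ?size_map ?addn0 ?addn1.
apply: card_set_seq => [|th].
  rewrite map_inj_in_uniq // => s t; rewrite !mem_l.
  move=> /and4P[/eqP size_s _ _ _] /and4P[/eqP size_t _ _ _] eq_f.
  by apply: (@rock_theta_inj v n) => // k k_lt; rewrite -!fE // eq_f.
split=> [[z0 [b [Q [ab odd_b]]]] | /mapP[s + ->]].
  have [|s [size_s s_le s_odd s_b]] := @rock_abacus_image v n w b Q _ ab.
    by lia.
  have Eth : th = f s.
    by apply: tuple_nth_inj => k k_lt; rewrite fE // odd_b // s_b.
  rewrite Eth; apply: map_f; rewrite mem_l size_s s_le s_odd !eqxx /=.
  by apply/implyP => /z0; rewrite Eth f_zero.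
rewrite mem_l => /and4P[/eqP size_s s_le /eqP s_odd /implyP s0].
split; first by rewrite f_zero.
have [b [Q [ab s_b]]] := rock_abacus_exists w_lt size_s s_le s_odd.
by exists b, Q; split=> // k k_lt; rewrite fE // s_b.
Qed.

Lemma card_absets n c w z : size c = n.*2.+1 -> all (leq w) c ->
  absets n.*2.+1 c w z #= `I_(size (comps (n + ~~ z) w)).
Proof.
move=> size_c c_ge; rewrite -(card_eqr (@card_absets_rock w.+1 n w z _)) //.
apply: card_absets_indep; rewrite ?size_mkseq //.
by apply/allP => _ /mapP[k _ ->]; lia.
Qed.

Local Close Scope card_scope.
Local Close Scope classical_set_scope.

(** * Partitions and the abacus *)

(** For [j < N] this is [lambda_j - j], with rows counted from 1, shifted by [N] to be natural; the
    partition is padded with zeros to [N] rows. *)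
Definition bead (N : nat) (lam : seq nat) (j : nat) : nat :=
  nth 0 lam j + (N - j.+1).

(** An arbitrary [F] of part and position transfers all statistics at once. The largest part becomes
    the topmost bead, which changes no gap count below it. *)
Lemma abacus_of_seq (s : seq nat) : sorted geq s ->
  exists b : nat -> bool,
    (forall z, head 0 s + size s <= z -> b z = false) /\
    forall L (F : nat -> nat -> nat), head 0 s + size s <= L ->
      \sum_(z < L) b z * F (gaps b z) z
      = \sum_(j < size s) F (nth 0 s j) (bead (size s) s j).
Proof.
elim: s => [|x s IHs] /= s_sorted.
  exists (fun=> false); split=> // L F _.
  by rewrite big_ord0 big1 // => z _; rewrite mul0n.
have [b [supp_b sum_b]] := IHs (path_sorted s_sorted).
have hd_x : head 0 s <= x by case: s s_sorted {IHs supp_b sum_b} => //= y s /andP[].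
pose b' z := b z || (z == x + size s); exists b'.
have b_eq z : z < x + size s -> b' z = b z.
  by move=> z_lt; rewrite /b' ltn_eqF // orbF.
have b'x : b' (x + size s) by rewrite /b' eqxx orbT.
have supp z : (x + size s).+1 <= z -> b' z = false.
  by move=> z_ge; rewrite /b' supp_b ?gtn_eqF //; lia.
have beads_x : beads b (x + size s) = size s.
  have := sum_b (x + size s) (fun _ _ => 1).
  rewrite sum1_card card_ord => beads_s; rewrite -[RHS]beads_s; last by lia.
  by apply: eq_bigr => z _; rewrite muln1.
have gaps_x : gaps b' (x + size s) = x.
  rewrite (@eq_gaps b' b) //.
  by have := gaps_beads b (x + size s); lia.
split=> [z z_ge | L F L_ge]; first by apply: supp; lia.
rewrite big_ord_recl /=.
have -> : bead (size s).+1 (x :: s) 0 = x + size s by rewrite /bead /= subn1.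
have -> : \sum_(j < size s) F (nth 0 (x :: s) (bump 0 j))
    (bead (size s).+1 (x :: s) (bump 0 j))
  = \sum_(j < size s) F (nth 0 s j) (bead (size s) s j).
  by apply: eq_bigr => j _; rewrite /bead /= subSS.
rewrite -(sum_b (x + size s)); last by lia.
have L_split : L = (x + size s) + (1 + (L - (x + size s).+1)) by lia.
rewrite L_split big_split_ord [X in _ + X = _]big_split_ord big_ord1 /= addn0 b'x gaps_x mul1n.
rewrite [X in _ + (_ + X)]big1 ?addn0 => [|i _]; last first.
  by rewrite supp ?mul0n //; lia.
rewrite [LHS]addnC; congr (_ + _); apply: eq_bigr => z _.
rewrite b_eq // (@eq_gaps b' b) // => y y_lt.
by apply: b_eq; apply: ltn_trans y_lt _.
Qed.

(** Positions are read upwards; each bead puts the current number of gaps in front as the new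
    largest part. *)
Lemma seq_of_abacus (b : nat -> bool) L : exists s,
  [/\ sorted geq s, size s = beads b L, head 0 s <= gaps b L &
    forall F : nat -> nat -> nat, \sum_(z < L) b z * F (gaps b z) z
      = \sum_(j < size s) F (nth 0 s j) (bead (size s) s j)].
Proof.
elim: L => [|L [s [s_sorted size_s hd_s sum_s]]].
  by exists [::]; split=> //=; rewrite /beads ?big_ord0 // => F; rewrite !big_ord0.
have := gaps_beads b L; case bL: (b L) => EL; last first.
  exists s; split=> //; rewrite ?beadsS ?gapsS ?bL ?addn0 //=; first by lia.
  by move=> F; rewrite big_ord_recr /= bL mul0n addn0 sum_s.
exists (gaps b L :: s); split=> /=.
- by case: s hd_s s_sorted {size_s sum_s} => //= y s -> ->.
- by rewrite beadsS bL size_s addn1.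
- by rewrite gapsS bL addn0.
move=> F; rewrite big_ord_recr big_ord_recl /= bL mul1n sum_s addnC.
by congr (F _ _ + _); rewrite /bead /= subn1 size_s EL.
Qed.

Lemma sum_residue e Q (f : nat -> nat) i : i < e ->
  \sum_(z < Q * e) f z * (z %% e == i) = \sum_(q < Q) f (q * e + i).
Proof.
move=> i_lt; rewrite (sum_blocks (fun z => f z * (z %% e == i))).
apply: eq_bigr => q _; rewrite (bigD1 (Ordinal i_lt)) //=.
rewrite modnMDl modn_small // eqxx muln1 big1 ?addn0 // => k.
by rewrite -val_eqE /= modnMDl modn_small // => /negbTE->; rewrite muln0.
Qed.

Definition rescount (e N : nat) (lam : seq nat) (i : nat) : nat :=
  \sum_(j < N) (bead N lam j %% e == i).

Definition oddres (e N : nat) (lam : seq nat) (i : nat) : nat :=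
  \sum_(j < N) (odd (nth 0 lam j) && (bead N lam j %% e == i)).

Definition rowheight (e N : nat) (lam : seq nat) : nat :=
  \sum_(j < N) bead N lam j %/ e.

Lemma abacus_stats e (b : nat -> bool) Q N (s : seq nat) :
    (forall F : nat -> nat -> nat, \sum_(z < Q * e) b z * F (gaps b z) z
      = \sum_(j < N) F (nth 0 s j) (bead N s j)) ->
  [/\ forall i, i < e -> beadcount e b Q i = rescount e N s i,
      forall i, i < e -> oddcount e b Q i = oddres e N s i &
      height e b Q = rowheight e N s].
Proof.
move=> sum_b; split.
- move=> i i_lt; rewrite -[RHS](sum_b (fun _ z => z %% e == i)).
  by rewrite (sum_residue Q b).
- move=> i i_lt; rewrite -[RHS](sum_b (fun g z => odd g && (z %% e == i))).
  rewrite /oddcount -(sum_residue Q (fun z => b z && odd (gaps b z))) //.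
  by apply: eq_bigr => z _; rewrite !mulnb andbA.
- rewrite -[RHS](sum_b (fun _ z => z %/ e)).
  rewrite (sum_blocks (fun z => b z * (z %/ e))) /height exchange_big /=.
  apply: eq_bigr => q _; apply: eq_bigr => k _.
  rewrite divnMDl ?divn_small ?addn0 1?mulnC //.
  by apply: leq_trans (ltn_ord k).
Qed.

Lemma exists_abacus e N (s : seq nat) : 0 < e -> sorted geq s -> size s <= N ->
  exists b Q, (forall z, Q * e <= z -> b z = false) /\
   [/\ forall i, i < e -> beadcount e b Q i = rescount e N s i,
      forall i, i < e -> oddcount e b Q i = oddres e N s i &
      height e b Q = rowheight e N s].
Proof.
move=> e_gt0 s_sorted size_s; pose t := s ++ nseq (N - size s) 0.
have size_t : size t = N by rewrite size_cat size_nseq subnKC.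
have nth_t j : nth 0 t j = nth 0 s j.
  rewrite nth_cat; case: ltnP => // le_j; rewrite nth_nseq if_same.
  by rewrite nth_default.
have t_sorted : sorted geq t.
  apply/(sortedP 0) => j; rewrite size_t !nth_t => j_lt.
  have [j1_lt | j1_ge] := ltnP j.+1 (size s); first exact: (sortedP 0 s_sorted).
  by rewrite (nth_default _ j1_ge).
have [b [supp sum_b]] := abacus_of_seq t_sorted.
exists b, (head 0 t + size t).
have le_Q : head 0 t + size t <= (head 0 t + size t) * e by rewrite leq_pmulr.
split=> [z le_z|]; first by apply: supp; apply: leq_trans le_z.
apply: abacus_stats => F; rewrite sum_b // size_t.
by apply: eq_bigr => j _; rewrite /bead !nth_t.
Qed.

Lemma partition_of_seq (s : seq nat) : sorted geq s ->
  exists lam, [/\ is_partition lam, size lam <= size s &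
    forall j, nth 0 lam j = nth 0 s j].
Proof.
move=> s_sorted; exists (filter (leq 1) s); split.
- rewrite /is_partition sorted_filter ?mem_filter ?ltnn //.
  by move=> y x z /= xy yz; apply: leq_trans yz xy.
- by rewrite size_filter count_size.
elim: s s_sorted => [|x s IHs] //= s_sorted j.
have {}IHs := IHs (path_sorted s_sorted).
case: x s_sorted => [|x] s_sorted /=; last by case: j => /=.
have s0 k : nth 0 s k = 0.
  elim: s {IHs} s_sorted k => [|y s IHs] /=; first by move=> _ k; rewrite nth_nil.
  by move=> /andP[]; rewrite leqn0 => /eqP-> s_sorted [|k] //=; apply: IHs.
by rewrite IHs s0; case: j => //= j; rewrite s0.
Qed.

Lemma exists_partition e (b : nat -> bool) Q N : beads b (Q * e) = N ->
  exists lam, [/\ is_partition lam, size lam <= N &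
   [/\ forall i, i < e -> beadcount e b Q i = rescount e N lam i,
      forall i, i < e -> oddcount e b Q i = oddres e N lam i &
      height e b Q = rowheight e N lam]].
Proof.
move=> beads_N; have [s [s_sorted size_s _ sum_s]] := seq_of_abacus b (Q * e).
have [lam [lamP size_lam nth_lam]] := partition_of_seq s_sorted.
exists lam; rewrite -beads_N -size_s; split=> //.
apply: abacus_stats => F; rewrite sum_s.
by apply: eq_bigr => j _; rewrite /bead !nth_lam.
Qed.

Lemma beads_beadcount e b Q : beads b (Q * e) = \sum_(i < e) beadcount e b Q i.
Proof. by rewrite /beads (sum_blocks b) exchange_big. Qed.

Lemma sum_rescount e N lam : 0 < e -> \sum_(i < e) rescount e N lam i = N.
Proof.
move=> e_gt0; rewrite exchange_big /= -[RHS]card_ord -sum1_card.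
apply: eq_bigr => j _; rewrite (bigD1 (Ordinal (ltn_pmod (bead N lam j) e_gt0))) //=.
by rewrite eqxx big1 // => i; rewrite -val_eqE /= eq_sym => /negbTE->.
Qed.

Lemma sumn_nth (s : seq nat) N : size s <= N -> sumn s = \sum_(j < N) nth 0 s j.
Proof.
move=> le_N; rewrite sumnE (big_nth 0) big_mkord -(subnKC le_N) big_split_ord /=.
rewrite [X in _ = _ + X]big1 ?addn0 // => j _.
by rewrite nth_default // leq_addr.
Qed.

(** Each bead position is divided by [e] with remainder. For fixed residue counts the size thus
    depends on the sum of the levels only. *)
Lemma sum_bead e N lam : 0 < e -> size lam <= N ->
  sumn lam + \sum_(j < N) (N - j.+1)
  = rowheight e N lam * e + \sum_(i < e) i * rescount e N lam i.
Proof.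
move=> e_gt0 le_N; rewrite (sumn_nth le_N) -big_split /=.
rewrite /rowheight big_distrl /=.
have -> : \sum_(i < e) i * rescount e N lam i = \sum_(j < N) bead N lam j %% e.
  under eq_bigr => i _ do rewrite /rescount big_distrr /=.
  rewrite exchange_big /=; apply: eq_bigr => j _.
  rewrite (bigD1 (Ordinal (ltn_pmod (bead N lam j) e_gt0))) //= eqxx muln1.
  by rewrite big1 ?addn0 // => i; rewrite -val_eqE /= eq_sym => /negbTE->; rewrite muln0.
by rewrite -big_split; apply: eq_bigr => j _; rewrite /= -divn_eq.
Qed.

Lemma residue_bead e m lam i j : j < m * e -> i < e ->
  ((nth 0%N lam j)%:Z - (j.+1)%:Z == i%:Z %[mod e%:Z])%Z
  = (bead (m * e) lam j %% e == i).
Proof.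
move=> j_lt i_lt; rewrite [in RHS]/bead.
have -> : ((nth 0%N lam j)%:Z - (j.+1)%:Z)%R =
    ((- m%:Z) * e%:Z + (nth 0 lam j + (m * e - j.+1))%:Z)%R.
  have Em : (m%:Z * e%:Z)%R = ((m * e - j.+1)%:Z + j.+1%:Z)%R.
    by rewrite -PoszM -PoszD subnK.
  by rewrite mulNr Em; move: (m * e - j.+1) (nth 0 lam j) => d x; lia.
by rewrite modzMDl !modz_nat (modn_small i_lt).
Qed.

Lemma odd_sequence_oddres e N lam i : e %| N -> size lam <= N ->
  i < e -> nth 0 (odd_sequence e lam) i = oddres e N lam i.
Proof.
move=> /dvdnP[m ->] le_N i_lt.
rewrite -(tnth_nth 0 _ (Ordinal i_lt)) tnth_mktuple -sum1_card.
transitivity (\sum_(j < size lam)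
    (odd (nth 0 lam j) && (bead (m * e) lam j %% e == i))).
  rewrite big_mkcond; apply: eq_bigr => j _.
  by rewrite inE /= (@residue_bead e m) ?(leq_trans (ltn_ord j)) //; case: (_ && _).
pose f j : nat := odd (nth 0 lam j) && (bead (m * e) lam j %% e == i).
rewrite -[LHS]/(\sum_(j < size lam) f j) -[RHS]/(\sum_(j < m * e) f j).
rewrite -(subnKC le_N) big_split_ord /= [X in _ = _ + X]big1 ?addn0 // => j _.
by rewrite /f nth_default ?leq_addr.
Qed.

(** * Rim hooks *)

Lemma perm_iota_down (K : seq nat) m : uniq K ->
    (forall x, x \in K -> m <= x) ->
    (forall x y, x \in K -> m <= y <= x -> y \in K) ->
  perm_eq K (iota m (size K)).
Proof.
move=> uK K_ge K_down; have sub : {subset K <= iota m (size K)}.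
  move=> x xK; have x_ge := K_ge x xK; rewrite mem_iota x_ge /=.
  suff : size (iota m (x.+1 - m)) <= size K by rewrite size_iota; lia.
  apply: uniq_leq_size; first exact: iota_uniq.
  by move=> y; rewrite mem_iota => y_in; apply: K_down xK _; lia.
apply: uniq_perm; rewrite ?iota_uniq //.
by have [] := uniq_min_size uK sub; rewrite ?size_iota.
Qed.

Lemma partition_nth_le lam i j :
  is_partition lam -> i <= j -> nth 0 lam j <= nth 0 lam i.
Proof.
move=> /andP[lam_sorted _] le_ij.
have [j_lt | j_ge] := ltnP j (size lam); last by rewrite nth_default.
have geq_trans : transitive geq by move=> y x z /= xy yz; apply: leq_trans yz xy.
have geq_refl : reflexive geq by move=> x /=.
by apply: (sorted_leq_nth geq_trans geq_refl 0 lam_sorted); rewrite ?inE //; lia.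
Qed.

Lemma partition_nth_gt0 lam j : is_partition lam -> j < size lam -> 0 < nth 0 lam j.
Proof.
move=> /andP[_ lam0] j_lt; rewrite lt0n; apply: contra lam0 => /eqP <-.
exact: mem_nth.
Qed.

Lemma partition_eq lam mu : is_partition lam -> is_partition mu ->
  (forall j, nth 0 lam j = nth 0 mu j) -> lam = mu.
Proof.
move=> lamP muP eq_nth; apply: (@eq_from_nth _ 0) => //.
apply/eqP; rewrite eqn_leq; apply/andP; split; rewrite leqNgt; apply/negP => lt_s.
  by have := partition_nth_gt0 lamP lt_s; rewrite eq_nth nth_default.
by have := partition_nth_gt0 muP lt_s; rewrite -eq_nth nth_default.
Qed.

Lemma bead_lt N lam i j : is_partition lam -> i < j -> j < N ->
  bead N lam j < bead N lam i.
Proof.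
by move=> lamP lt_ij; have := partition_nth_le lamP (ltnW lt_ij); rewrite /bead; lia.
Qed.

Lemma bead_inj N lam i j : is_partition lam -> i < N -> j < N ->
  bead N lam i = bead N lam j -> i = j.
Proof.
move=> lamP i_lt j_lt; have [lt_ij | lt_ji | //] := ltngtP i j.
  by have := bead_lt lamP lt_ij j_lt; lia.
by have := bead_lt lamP lt_ji i_lt; lia.
Qed.

Lemma big_iota_ord (F : nat -> nat) n :
  \sum_(x <- iota 0 n) F x = \sum_(x < n) F x.
Proof. by rewrite -val_enum_ord big_map big_enum. Qed.

(** Telescoping of [f (x + 1) - f x], written without subtraction. *)
Lemma telescope_iota (f : nat -> nat) m k d :
  \sum_(c <- iota m k) f (c + d).+1 + f (m + d)
  = \sum_(c <- iota m k) f (c + d) + f (m + k + d).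
Proof.
elim: k m => [|k IHk] m; first by rewrite !big_nil addn0.
have := IHk m.+1; rewrite /= !big_cons addnS !addSn.
by move: (bigop _ _ _) (bigop _ _ _) => S1 S0; lia.
Qed.

Lemma rim_hook_size e lam mu : rim_hook_removal e lam mu -> size mu <= size lam.
Proof.
case=> muP le_mu _ _ _; rewrite leqNgt; apply/negP => lt_s.
have := le_mu (size lam); rewrite [nth 0 lam _]nth_default //.
by have := partition_nth_gt0 muP lt_s; lia.
Qed.

(** Discrete intermediate values: [kappa] is the content shifted by [N], and a step to an adjacent
    cell raises it by at most one. *)
Lemma path_content_ivt N (S : pred (nat * nat)) c p z :
    let kappa (c : nat * nat) := c.2 + (N - c.1.+1) in
    S c -> path [rel x y | adjacent x y && S y] c p ->
    kappa c <= z <= kappa (last c p) -> exists2 d, S d & kappa d = z.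
Proof.
move=> kappa; elim: p c => [|d p IHp] c Sc /=.
  by move=> _ z_in; exists c => //; lia.
move=> /andP[/andP[adj Sd] pth] /andP[z_ge z_le].
have [<- | ne] := eqVneq (kappa c) z; first by exists c.
apply: (IHp d) => //; rewrite z_le andbT.
have : kappa d <= (kappa c).+1; last by lia.
move: adj; rewrite /adjacent /kappa.
by case: c d {IHp Sc Sd pth z_ge z_le ne} => [r x] [r' x'] /=; lia.
Qed.

(** The contents of the cells of a rim hook are [e] consecutive integers. Summing the differences of
    a residue indicator over them, by rows and along the interval, compares the beads of [lam] and
    [mu]. *)
Lemma rescount_rim_hook e N lam mu : 0 < e -> is_partition lam ->
    size lam <= N -> rim_hook_removal e lam mu ->
  forall i, rescount e N lam i = rescount e N mu i.
Proof.
move=> e_gt0 lamP le_N hook i; have le_N' := leq_trans (rim_hook_size hook) le_N.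
case: hook => muP le_mu sum_e conn nosq.
pose cells := [seq (r, c) | r <- iota 0 N,
                            c <- iota (nth 0 mu r) (nth 0 lam r - nth 0 mu r)].
pose kappa (c : nat * nat) := c.2 + (N - c.1.+1).
have mem_cells c : (c \in cells) = in_skew lam mu c.
  case: c => r c; rewrite /in_skew /in_diagram /=.
  apply/allpairsPdep/andP => [[r' [c' [r_in c_in [-> ->]]]] | [c_lt c_ge]].
    by move: c_in; rewrite mem_iota; lia.
  exists r, c; split=> //; rewrite mem_iota; last by lia.
  rewrite add0n /=; apply: contraTT c_lt; rewrite -leqNgt => r_ge.
  by rewrite nth_default //; lia.
pose K := map kappa cells.
have row_lt r c : in_skew lam mu (r, c) -> r < N.
  rewrite /in_skew /in_diagram /= => /andP[c_lt _]; apply: contraTT c_lt.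
  by rewrite -leqNgt => r_ge; rewrite nth_default //; lia.
(* Two cells on one diagonal would force a 2 x 2 square, so contents are distinct. *)
have diag r c k : in_skew lam mu (r, c) -> in_skew lam mu (r + k.+1, c + k.+1) ->
    False.
  move=> sk sk'; apply: (negP (nosq r c)).
  have l1 := partition_nth_le lamP (leqnSn r); have m1 := partition_nth_le muP (leqnSn r).
  have l2 : nth 0 lam (r + k.+1) <= nth 0 lam r.+1 by apply: partition_nth_le => //; lia.
  move: sk sk'; rewrite /in_skew /in_diagram /=; lia.
have uK : uniq K.
  rewrite map_inj_in_uniq; last first.
    move=> [r c] [r' c']; rewrite !mem_cells => sk sk'.
    have r_lt := row_lt _ _ sk; have r_lt' := row_lt _ _ sk'.
    rewrite /kappa /= => eq_k.
    have [lt_r | lt_r | eq_r] := ltngtP r r'.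
    - have [Er Ec] : r' = r + (r' - r.+1).+1 /\ c' = c + (r' - r.+1).+1 by lia.
      by case: (diag r c (r' - r.+1)); rewrite -?Er -?Ec.
    - have [Er Ec] : r = r' + (r - r'.+1).+1 /\ c = c' + (r - r'.+1).+1 by lia.
      by case: (diag r' c' (r - r'.+1)); rewrite -?Er -?Ec.
    - by congr (_, _); lia.
  apply: allpairs_uniq_dep; first exact: iota_uniq.
    by move=> r _; apply: iota_uniq.
  by move=> [r c] [r' c'] _ _ /= [-> ->].
have size_K : size K = e.
  rewrite size_map size_allpairs_dep sumnE big_map big_iota_ord.
  apply/eqP; rewrite -(eqn_add2l (sumn mu)) -sum_e (sumn_nth le_N) (sumn_nth le_N').
  rewrite -big_split; apply/eqP; apply: eq_bigr => r _ /=.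
  by rewrite size_iota subnKC.
have [m mK m_min] : exists2 m, m \in K & forall x, x \in K -> m <= x.
  have exK : exists x, x \in K by case: (K) size_K e_gt0 => [<-|x s] //; exists x; rewrite inE eqxx.
  by exists (ex_minn exK); case: ex_minnP.
have K_int : perm_eq K (iota m e).
  rewrite -[e in iota _ e]size_K; apply: perm_iota_down => // x y xK y_in.
  have /mapP[cx + Ex] := xK; have /mapP[cm + Em] := mK.
  rewrite !mem_cells => skm skx; have [p pth last_p] := conn _ _ skm skx.
  have [|d skd <-] := @path_content_ivt N (in_skew lam mu) cm p y skm pth.
    by rewrite last_p -/(kappa _) -/(kappa _) -Em -Ex.
  by apply: map_f; rewrite mem_cells.
pose f x : nat := x %% e == i.
(* Along the interval the differences telescope to [f (m + e) - f m], which vanishes by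
   periodicity. *)
have sum_K : \sum_(x <- K) f x.+1 = \sum_(x <- K) f x.
  have rm0 g : \sum_(c <- iota m e) g (c + 0) = \sum_(c <- iota m e) g c :> nat.
    by apply: eq_bigr => c _; rewrite addn0.
  rewrite !(perm_big _ K_int) /=; have := telescope_iota f m e 0.
  by rewrite !addn0 (rm0 (fun c => f c.+1)) (rm0 f) {2 4}/f modnDr => /addIn.
have sum_cells (g : nat -> nat) : \sum_(x <- K) g x = \sum_(r < N)
    \sum_(c <- iota (nth 0 mu r) (nth 0 lam r - nth 0 mu r)) g (c + (N - r.+1)).
  by rewrite big_map big_allpairs_dep big_iota_ord.
(* In each row they telescope from the bead of [mu] to the bead of [lam]. *)
apply/eqP; rewrite /rescount -(eqn_add2r (\sum_(x <- K) f x)).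
rewrite -{2}sum_K !sum_cells -!big_split /=; apply/eqP/eq_bigr => r _.
have := telescope_iota f (nth 0 mu r) (nth 0 lam r - nth 0 mu r) (N - r.+1).
by rewrite subnKC // => Ef; rewrite addnC [RHS]addnC; apply: esym.
Qed.

(** * Rim hooks from free positions *)

Definition linked (lam mu : seq nat) (c d : nat * nat) : Prop :=
  exists2 p, path [rel x y | adjacent x y && in_skew lam mu y] c p & last c p = d.

Lemma linked_trans lam mu c d f :
  linked lam mu c d -> linked lam mu d f -> linked lam mu c f.
Proof.
move=> [p p_path <-] [q q_path <-]; exists (p ++ q); last by rewrite last_cat.
by rewrite cat_path p_path.
Qed.

Lemma linked_step lam mu c d :
  adjacent c d -> in_skew lam mu d -> linked lam mu c d.
Proof. by move=> adj sk; exists [:: d] => //=; rewrite adj sk. Qed.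

Lemma adjacent_sym c d : adjacent c d = adjacent d c.
Proof. by rewrite /adjacent; case: c d => [r x] [r' x'] /=; lia. Qed.

Section RemoveHook.

Variables (e N : nat) (lam : seq nat) (r : nat).
Hypotheses (lamP : is_partition lam) (le_N : size lam <= N).
Hypotheses (r_lt : r < N) (e_gt0 : 0 < e) (e_le : e <= bead N lam r).

Let g := bead N lam r - e.
Hypothesis g_free : forall j, j < N -> bead N lam j <> g.

(** The bead of row [r] is moved down to the free position [g]. It passes the beads of rows [r + 1]
    to [s], whose rows move up by one and lose one cell each; the moved bead becomes row [s]. *)
Lemma rim_hook_exists : exists mu, rim_hook_removal e lam mu.
Proof.
have mono j : nth 0 lam j.+1 <= nth 0 lam j by apply: partition_nth_le.
have lam0 j : N <= j -> nth 0 lam j = 0 by move=> j_ge; rewrite nth_default //; lia.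
have exP : exists s, (s < N) && (g < bead N lam s).
  by exists r; rewrite r_lt /g; lia.
have boundP s : (s < N) && (g < bead N lam s) -> s <= N by lia.
have [s /andP[s_lt g_lt] s_max] := ex_maxnP exP boundP.
have rs : r <= s by apply: s_max; rewrite r_lt /g; lia.
have gE : g + e = bead N lam r by rewrite /g; lia.
have after_s : s.+1 < N -> bead N lam s.+1 < g.
  move=> s1_lt; have := g_free s1_lt; have := s_max s.+1; rewrite s1_lt; lia.
(* If a passed row were zero, all later rows would be zero too, and one of their beads would occupy
   [g]. *)
have pos t : r <= t -> t < s -> 0 < nth 0 lam t.+1.
  move=> t_ge t_lt; rewrite lt0n; apply/eqP => lam_t.
  have bt : g < bead N lam t.+1.
    have [-> // | ne] := eqVneq t.+1 s.
    by apply: ltn_trans g_lt (bead_lt lamP _ s_lt); lia.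
  have g_le : g < N - t.+2 by move: bt; rewrite /bead lam_t.
  apply: (@g_free (N - g.+1)); first by lia.
  have : nth 0 lam (N - g.+1) <= nth 0 lam t.+1 by apply: partition_nth_le => //; lia.
  by rewrite /bead lam_t; lia.
have lam_s1 : nth 0 lam s.+1 <= g - (N - s.+1) /\ N - s.+1 <= g.
  have [s1_lt | s1_ge] := ltnP s.+1 N; last by rewrite lam0 //; lia.
  by have := after_s s1_lt; rewrite /bead; lia.
have lam_s : g - (N - s.+1) < nth 0 lam s by move: g_lt; rewrite /bead; lia.
pose m t := if t < r then nth 0 lam t else
  if t < s then (nth 0 lam t.+1).-1 else
  if t == s then g - (N - s.+1) else nth 0 lam t.
have m_lt t : t < r -> m t = nth 0 lam t by rewrite /m => ->.
have m_mid t : r <= t -> t < s -> m t = (nth 0 lam t.+1).-1.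
  by rewrite /m leqNgt => /negbTE-> ->.
have m_s : m s = g - (N - s.+1) by rewrite /m ltnn eqxx ltnNge rs.
have m_gt t : s < t -> m t = nth 0 lam t.
  by move=> st; rewrite /m !ifF //; lia.
have m_mono t : m t.+1 <= m t.
  have := mono t; have := mono t.+1.
  have [t_s | t_s | ->] := ltngtP t s; last by rewrite m_s m_gt //; lia.
    have [t_r | t_r] := ltnP t r.
      rewrite (m_lt t) //; have [t1_r | t1_r] := ltnP t.+1 r; first by rewrite m_lt.
      have [t1_s | t1_s] := ltnP t.+1 s; first by rewrite m_mid //; lia.
      have -> : t.+1 = s by lia.
      by rewrite m_s; lia.
    rewrite (m_mid t) //; have [t1_s | t1_s] := ltnP t.+1 s.
      by rewrite m_mid //; lia.
    have -> : t.+1 = s by lia.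
    by rewrite m_s; lia.
  by rewrite !m_gt //; lia.
have m_le t : m t <= nth 0 lam t.
  have := mono t; have [t_s | t_s | ->] := ltngtP t s; last by rewrite m_s; lia.
    by have [t_r | t_r] := ltnP t r; [rewrite m_lt | rewrite m_mid //; lia].
  by rewrite m_gt.
have m_N t : N <= t -> m t = 0 by move=> t_ge; rewrite m_gt ?lam0 //; lia.
have m_sorted : sorted geq (mkseq m N).
  apply/(sortedP 0) => j; rewrite size_mkseq => j_lt.
  by rewrite !nth_mkseq //; [apply: m_mono | lia].
have [mu [muP size_mu nth_mu]] := partition_of_seq m_sorted.
have mE t : nth 0 mu t = m t.
  rewrite nth_mu; have [t_lt | t_ge] := ltnP t N; first by rewrite nth_mkseq.
  by rewrite nth_default ?size_mkseq // m_N.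
have skE t c : in_skew lam mu (t, c) = (m t <= c < nth 0 lam t).
  by rewrite /in_skew /in_diagram /= mE -leqNgt andbC.
exists mu; split=> //.
- by move=> t; rewrite mE.
- rewrite size_mkseq in size_mu; rewrite (sumn_nth le_N) (sumn_nth size_mu).
  have -> : \sum_(t < N) nth 0 mu t = \sum_(t < N) m t.
    by apply: eq_bigr => t _; rewrite mE.
  pose A k := \sum_(t < k) nth 0 lam t; pose B k := \sum_(t < k) m t.
  have AS k : A k.+1 = A k + nth 0 lam k by rewrite /A big_ord_recr.
  have BS k : B k.+1 = B k + m k by rewrite /B big_ord_recr.
  (* Between [r] and [s] the partial sums telescope, with one cell lost per row. *)
  suff H k : if k <= r then A k = B k else
      if k <= s then A k + nth 0 lam k = B k + nth 0 lam r + (k - r)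
      else A k = B k + e.
    have := H N; rewrite !ifF -/(A N) -/(B N); try lia.
  elim: k => [|k]; first by rewrite /A /B !big_ord0.
  rewrite AS BS; have [k_r | k_r | ->] := ltngtP k r.
  + by rewrite m_lt // => ->.
  + have [k_s | k_s | ->] := ltngtP k s.
    * by rewrite m_mid ?(ltnW k_r) //; have := pos k (ltnW k_r) k_s; lia.
    * by rewrite m_gt //; lia.
    * by rewrite m_s; move: gE lam_s1; rewrite /bead; lia.
  + have [r_s | r_s] := ltnP r s.
      by rewrite m_mid //; have := pos r (leqnn r) r_s; lia.
    have Es : s = r by lia.
    by move: m_s gE lam_s1; rewrite Es /bead => ->; lia.
- pose base := (s, m s).
  have sk_rs t c : in_skew lam mu (t, c) -> r <= t <= s.
    rewrite skE => sk; apply/andP; split; rewrite leqNgt; apply/negP => lt_t.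
      by rewrite m_lt // in sk; lia.
    by rewrite m_gt // in sk; lia.
  (* Each cell is joined to the first cell of row [s]: go left to the first cell of its row, below
     which lies the last cell of the next row. *)
  have to_base k t c : t + k = s -> in_skew lam mu (t, c) ->
      linked lam mu (t, c) base /\ linked lam mu base (t, c).
    elim: k t c => [|k IHk] t c Ek sk; have := sk; rewrite skE => /andP[c_ge c_lt];
      rewrite -(subnKC c_ge); (have : m t + (c - m t) < nth 0 lam t by lia);
      elim: (c - m t) => [|d IHd].
    + by move=> _; rewrite addn0 -[t]addn0 Ek; split; exists [::].
    + move=> d_lt; have [|l1 l2] := IHd; first by lia.
      have sk1 : in_skew lam mu (t, m t + d) by rewrite skE; lia.
      have sk2 : in_skew lam mu (t, m t + d.+1) by rewrite skE; lia.
      have adj : adjacent (t, m t + d) (t, m t + d.+1).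
        by rewrite /adjacent /=; lia.
      split.
        by apply: linked_trans l1; apply: linked_step; rewrite // adjacent_sym.
      by apply: (linked_trans l2); apply: linked_step.
    + move=> _; rewrite addn0; have /andP[r_t _] := sk_rs _ _ sk.
      have t_s : t < s by lia.
      have mt := m_mid t r_t t_s; have pt := pos t r_t t_s.
      have sk1 : in_skew lam mu (t.+1, m t) by rewrite skE m_mono; lia.
      have sk2 : in_skew lam mu (t, m t) by rewrite skE; lia.
      have [|l1 l2] := IHk t.+1 (m t) _ sk1; first by lia.
      have adj : adjacent (t, m t) (t.+1, m t) by rewrite /adjacent /=; lia.
      split; first exact: linked_trans (linked_step adj sk1) l1.
      by apply: (linked_trans l2); apply: linked_step; rewrite // adjacent_sym.
    + move=> d_lt; have [|l1 l2] := IHd; first by lia.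
      have sk1 : in_skew lam mu (t, m t + d) by rewrite skE; lia.
      have sk2 : in_skew lam mu (t, m t + d.+1) by rewrite skE; lia.
      have adj : adjacent (t, m t + d) (t, m t + d.+1).
        by rewrite /adjacent /=; lia.
      split.
        by apply: linked_trans l1; apply: linked_step; rewrite // adjacent_sym.
      by apply: (linked_trans l2); apply: linked_step.
  move=> [t c] [t' c'] sk sk'.
  have /andP[_ t_le] := sk_rs _ _ sk; have /andP[_ t_le'] := sk_rs _ _ sk'.
  have [l1 _] := to_base (s - t) t c (subnKC t_le) sk.
  have [_ l2] := to_base (s - t') t' c' (subnKC t_le') sk'.
  exact: linked_trans l1 l2.
- move=> i j; apply/negP; rewrite !skE => /and4P[/andP[m_j _] _ _ /andP[_ j_lt]].
  have [i_s | i_s | Ei] := ltngtP i s.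
  + have [i_r | i_r] := ltnP i r.
      by have := mono i; rewrite m_lt // in m_j; lia.
    by rewrite m_mid // in m_j; lia.
  + by have := mono i; rewrite m_gt // in m_j; lia.
  + by rewrite Ei in m_j j_lt; rewrite m_s in m_j; lia.
Qed.

End RemoveHook.

(** * Cores *)

Definition hookfree (e : nat) (lam : seq nat) : Prop :=
  forall mu, ~ rim_hook_removal e lam mu.

Definition bead_seq (N : nat) (lam : seq nat) : seq nat := mkseq (bead N lam) N.

Lemma mem_bead_seq N lam z :
  reflect (exists2 j, j < N & bead N lam j = z) (z \in bead_seq N lam).
Proof.
apply: (iffP mapP) => [[j + ->] | [j j_lt <-]].
  by rewrite mem_iota => j_in; exists j => //; lia.
by exists j; rewrite // mem_iota; lia.
Qed.

Lemma low_bead N lam k : k + size lam < N -> k \in bead_seq N lam.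
Proof.
move=> k_lt; apply/mem_bead_seq; exists (N - k.+1); first by lia.
by rewrite /bead nth_default; lia.
Qed.

Lemma hookfree_flush e N lam z : 0 < e -> is_partition lam -> size lam <= N ->
  hookfree e lam -> z \in bead_seq N lam -> e <= z -> z - e \in bead_seq N lam.
Proof.
move=> e_gt0 lamP le_N free /mem_bead_seq[r r_lt <-] e_le.
apply/negPn/negP => /mem_bead_seq notin.
have [j j_lt Ej|mu] := rim_hook_exists lamP le_N r_lt e_gt0 e_le; last exact: free.
by apply: notin; exists j.
Qed.

Section Flush.

Variables (e N : nat) (lam : seq nat).
Hypotheses (e_gt0 : 0 < e) (lamP : is_partition lam).
Hypothesis flush : forall z,
  z \in bead_seq N lam -> e <= z -> z - e \in bead_seq N lam.

Let levels i := [seq z %/ e | z <- bead_seq N lam & z %% e == i].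

Let uniq_bead_seq : uniq (bead_seq N lam).
Proof.
rewrite map_inj_in_uniq ?iota_uniq // => i j; rewrite !mem_iota => i_in j_in.
by apply: bead_inj => //; lia.
Qed.

Let mem_levels i q : i < e -> (q \in levels i) = (q * e + i \in bead_seq N lam).
Proof.
move=> i_lt; apply/mapP/idP => [[z] | qi].
  by rewrite mem_filter => /andP[/eqP<- z_in] ->; rewrite -divn_eq.
exists (q * e + i); first by rewrite mem_filter modnMDl modn_small ?eqxx.
by rewrite divnMDl // divn_small ?addn0.
Qed.

Let size_levels i : size (levels i) = rescount e N lam i.
Proof.
rewrite size_map size_filter /rescount /bead_seq count_map -sum1_count big_mkcond.
rewrite big_iota_ord; apply: eq_bigr => j _ /=; by case: eqP.
Qed.

Let perm_levels i : i < e -> perm_eq (levels i) (iota 0 (rescount e N lam i)).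
Proof.
move=> i_lt; rewrite -size_levels; apply: perm_iota_down => //.
  rewrite map_inj_in_uniq ?filter_uniq // => z z'; rewrite !mem_filter.
  move=> /andP[/eqP Ez _] /andP[/eqP Ez' _] Eq.
  by rewrite (divn_eq z e) (divn_eq z' e) Ez Ez' Eq.
move=> x y; rewrite !mem_levels // => x_in /andP[_ le_yx].
rewrite -(subKn le_yx); elim: (x - y) => [|k IHk]; first by rewrite subn0.
have [k_lt | k_ge] := ltnP k x; last by move: IHk; have -> : x - k.+1 = x - k by lia.
have := flush IHk; have -> : (x - k) * e + i = ((x - k.+1) * e + i) + e.
  by have -> : x - k = (x - k.+1).+1 by [lia]; rewrite mulSn; lia.
by rewrite addnK; apply; rewrite leq_addl.
Qed.

(** Flushness makes the occupied levels of each runner an initial segment, so the counts determine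
    the beads. *)
Lemma mem_flush z :
  (z \in bead_seq N lam) = (z %/ e < rescount e N lam (z %% e)).
Proof.
have z_lt := ltn_pmod z e_gt0.
by rewrite [in LHS](divn_eq z e) -mem_levels // (perm_mem (perm_levels z_lt)) mem_iota.
Qed.

Lemma rowheight_flush :
  rowheight e N lam = \sum_(i < e) 'C(rescount e N lam i, 2).
Proof.
have -> : rowheight e N lam = \sum_(z <- bead_seq N lam) z %/ e.
  by rewrite /bead_seq big_map big_iota_ord.
transitivity (\sum_(z <- bead_seq N lam) \sum_(i < e) (z %% e == i) * (z %/ e)).
  apply: eq_bigr => z _; rewrite (bigD1 (Ordinal (ltn_pmod z e_gt0))) //=.
  rewrite eqxx mul1n big1 ?addn0 // => i.
  by rewrite -val_eqE /= eq_sym => /negbTE->.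
rewrite exchange_big; apply: eq_bigr => i _ /=.
rewrite -bin2_sum big_mkord -(big_iota_ord id) -(perm_big _ (perm_levels (ltn_ord i))) /=.
rewrite [RHS]big_map [RHS]big_filter [RHS]big_mkcond /=.
by apply: eq_bigr => z _; case: eqP; rewrite ?mul1n ?mul0n.
Qed.

End Flush.

Lemma flush_eq e N lam mu : 0 < e -> is_partition lam -> is_partition mu ->
    size lam <= N -> size mu <= N -> hookfree e lam -> hookfree e mu ->
    (forall i, i < e -> rescount e N lam i = rescount e N mu i) ->
  lam = mu.
Proof.
move=> e_gt0 lamP muP lamN muN freel freem eq_c.
have fl z := @hookfree_flush e N lam z e_gt0 lamP lamN freel.
have fm z := @hookfree_flush e N mu z e_gt0 muP muN freem.
have sorted_b s : is_partition s -> sorted gtn (bead_seq N s).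
  move=> sP; apply/(sortedP 0) => j; rewrite size_mkseq => j_lt.
  rewrite !nth_mkseq //; last by lia.
  by apply: bead_lt.
have eq_b : bead_seq N lam = bead_seq N mu.
  apply: (@irr_sorted_eq _ gtn); try exact: sorted_b.
  - by move=> y x z /= xy yz; apply: ltn_trans yz xy.
  - by move=> x /=; rewrite ltnn.
  - move=> z; rewrite (mem_flush e_gt0 lamP fl) (mem_flush e_gt0 muP fm) eq_c //.
    exact: ltn_pmod.
apply: partition_eq => // j; have [j_lt | j_ge] := ltnP j N.
  have := congr1 (fun s => nth 0 s j) eq_b; rewrite /= !nth_mkseq //.
  by rewrite /bead => /addIn.
by rewrite !nth_default // (leq_trans _ j_ge).
Qed.

Lemma has_core_rescount e N lam gam : 0 < e -> has_core e lam gam ->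
    is_partition lam -> size lam <= N ->
  [/\ is_partition gam, size gam <= size lam, sumn gam <= sumn lam, hookfree e gam &
    forall i, rescount e N lam i = rescount e N gam i].
Proof.
move=> e_gt0; elim=> {lam gam} [lam free | lam mu gam hook _ IH] lamP lamN.
  by split.
have muP : is_partition mu by case: hook.
have size_mu := rim_hook_size hook.
have [|gamP size_gam sum_gam free eq_c] := IH muP; first exact: leq_trans lamN.
split=> //; first exact: leq_trans size_mu.
  by case: hook => _ _ -> _ _; apply: leq_trans sum_gam (leq_addr _ _).
by move=> i; rewrite (rescount_rim_hook e_gt0 lamP lamN hook).
Qed.

Lemma exists_core e lam : 0 < e -> is_partition lam -> exists gam, has_core e lam gam.
Proof.
move=> e_gt0; have [n] := ubnP (sumn lam); elim: n lam => // n IHn lam lam_lt lamP.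
have [[mu hook] | free] := pselect (exists mu, rim_hook_removal e lam mu).
  have [muP _ sum_e _ _] := hook.
  have [||gam mu_gam] := IHn mu; [by lia | by [] | ].
  by exists gam; apply: CoreStep hook mu_gam.
by exists lam; apply: CoreDone => mu hook; apply: free; exists mu.
Qed.

Lemma core_hookfree e gam : 0 < e -> is_core_partition e gam -> hookfree e gam.
Proof.
move=> e_gt0 [gamP core].
by have [] := has_core_rescount e_gt0 core gamP (leqnn _).
Qed.

(** Removing hooks keeps the residue counts, and these determine a hook-free partition; this also
    gives uniqueness of the core. *)
Lemma has_coreP e N lam gam : 0 < e -> is_partition lam -> size lam <= N ->
    is_core_partition e gam -> size gam <= N ->
  has_core e lam gam <->
  (forall i, i < e -> rescount e N lam i = rescount e N gam i).
Proof.
move=> e_gt0 lamP lamN gamC gamN; split=> [core | eq_c].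
  by have [_ _ _ _ eq_c] := has_core_rescount e_gt0 core lamP lamN.
have [mu core] := exists_core e_gt0 lamP.
have [muP size_mu _ free eq_mu] := has_core_rescount e_gt0 core lamP lamN.
suff <- : mu = gam by [].
apply: (@flush_eq e N) => //; first by case: gamC.
- exact: leq_trans lamN.
- exact: core_hookfree.
- by move=> i i_lt; rewrite -eq_mu eq_c.
Qed.

(** [sum_bead] is applied to both partitions, whose residue terms agree; the height of the flush
    core is the binomial sum. *)
Lemma core_weight e N lam gam : 0 < e -> is_partition lam -> size lam <= N ->
    is_core_partition e gam -> size gam <= N -> has_core e lam gam ->
  sumn lam = sumn gam
    + (rowheight e N lam - \sum_(i < e) 'C(rescount e N gam i, 2)) * e /\
  \sum_(i < e) 'C(rescount e N gam i, 2) <= rowheight e N lam.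
Proof.
move=> e_gt0 lamP lamN gamC gamN core.
have gamP : is_partition gam by case: gamC.
have [_ _ sum_le _ eq_c] := has_core_rescount e_gt0 core lamP lamN.
have fg z := @hookfree_flush e N gam z e_gt0 gamP gamN (core_hookfree e_gt0 gamC).
rewrite -(rowheight_flush e_gt0 gamP fg).
have := sum_bead e_gt0 gamN; have := sum_bead e_gt0 lamN.
have -> : \sum_(i < e) i * rescount e N lam i = \sum_(i < e) i * rescount e N gam i.
  by apply: eq_bigr => i _; rewrite eq_c.
move: (\sum_(i < e) i * _) (\sum_(j < N) _) => T S El Eg; have le_h : rowheight e N gam <= rowheight e N lam.
  by rewrite -(leq_pmul2r e_gt0); lia.
by split=> //; rewrite mulnBl; have := leq_mul2r e (rowheight e N gam) (rowheight e N lam);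
  rewrite le_h orbT; lia.
Qed.

Lemma oddseqs_absets e gam w : 0 < e -> is_core_partition e gam ->
  exists c, [/\ size c = e, all (leq w) c &
    forall theta, oddseqs e gam w theta <-> absets e c w false theta].
Proof.
move=> e_gt0 gamC; have gamP : is_partition gam by case: gamC.
(* A multiple of [e], so that residues are not shifted, and large enough to exceed the length of
   every partition involved and to put at least [w] beads on each runner. *)
pose N := (sumn gam + w * e + w) * e.
have N_ge : sumn gam + w * e + w * e <= N.
  by rewrite /N mulnDl leq_add2r leq_pmulr.
have dvd_N : e %| N by rewrite dvdn_mull.
have gamN : size gam <= N.
  by have := size_le_sumn (proj2 (andP gamP)); lia.
have gam_fl z := @hookfree_flush e N gam z e_gt0 gamP gamN (core_hookfree e_gt0 gamC).
pose c := mkseq (rescount e N gam) e.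
have c_nth i : i < e -> nth 0 c i = rescount e N gam i by move=> i_lt; rewrite nth_mkseq.
have sumc : \sum_(i < e) 'C(nth 0 c i, 2) = \sum_(i < e) 'C(rescount e N gam i, 2).
  by apply: eq_bigr => i _; rewrite c_nth.
exists c; split; first by rewrite size_mkseq.
  apply/(all_nthP 0) => i; rewrite size_mkseq => i_lt; rewrite c_nth //.
  have [-> // | w_gt0] := posnP w.
  (* This position is held by a zero part of [gam], so level [w.-1] of runner [i] is occupied. *)
  have := mem_flush e_gt0 gamP gam_fl (w.-1 * e + i).
  rewrite modnMDl modn_small // divnMDl // divn_small // addn0 prednK // => <-.
  have Ew : w * e = w.-1 * e + e by rewrite -mulSnr prednK.
  have gam_s := size_le_sumn (proj2 (andP gamP)).
  have : w.-1 * e + i < w * e by rewrite Ew ltn_add2l.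
  move=> k_lt; apply: low_bead; apply: leq_trans N_ge.
  by rewrite addnC -addnS; apply: leq_add => //; lia.
move=> theta; split=> [[lam [lamP core w_eq ->]] | [_ [b [Q [ab odd_b]]]]].
  have lam_sum : sumn lam = sumn gam + w * e.
    (* The size formula is first used with another number of beads, because [size lam <= N] is
       deduced from it. *)
    have lamM : size lam <= maxn (size lam) (size gam) by rewrite leq_maxl.
    have gamM : size gam <= maxn (size lam) (size gam) by rewrite leq_maxr.
    have [lam_sum _] := core_weight e_gt0 lamP lamM gamC gamM core.
    by move: w_eq; rewrite lam_sum addKn mulnK // => ->.
  have lamN : size lam <= N.
    by have := size_le_sumn (proj2 (andP lamP)); lia.
  have [sum_h le_h] := core_weight e_gt0 lamP lamN gamC gamN core.
  have [_ _ _ _ eq_c] := has_core_rescount e_gt0 core lamP lamN.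
  have [b [Q [supp [cnt odd_b ht]]]] := exists_abacus e_gt0 (proj1 (andP lamP)) lamN.
  split=> //; exists b, Q; split; last first.
    by move=> i i_lt; rewrite (odd_sequence_oddres dvd_N lamN) // odd_b.
  split=> //; first by move=> i i_lt; rewrite cnt // c_nth.
  rewrite ht sumc; move: sum_h; rewrite lam_sum => /addnI/eqP.
  by rewrite eqn_pmul2r // => /eqP->; rewrite subnK.
have beads_N : beads b (Q * e) = N.
  rewrite beads_beadcount -(sum_rescount N gam e_gt0); apply: eq_bigr => i _.
  by rewrite (abacus_count ab) // c_nth.
have [lam [lamP lamN [cnt odd_l ht]]] := exists_partition beads_N.
have core : has_core e lam gam.
  apply/(has_coreP e_gt0 lamP lamN gamC gamN) => i i_lt.
  by rewrite -cnt // (abacus_count ab) // c_nth.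
exists lam; split=> //; last first.
  apply: tuple_nth_inj => i i_lt.
  by rewrite (odd_sequence_oddres dvd_N lamN) // odd_b // odd_l.
have [-> _] := core_weight e_gt0 lamP lamN gamC gamN core.
by rewrite addKn mulnK // -ht (abacus_height ab) sumc addnK.
Qed.

(** * Generating functions *)

Local Open Scope classical_set_scope.

Lemma oddseqs_add2 e gam w theta : 0 < e -> is_core_partition e gam ->
  oddseqs e gam w theta -> oddseqs e gam w.+2 theta.
Proof.
move=> e_gt0 gamC [lam [lamP core w_eq ->]].
(* Parities and residues of the beads are unchanged. The empty partition becomes the single row
   [2e], whose even part is not counted. *)
pose lam' := head 0 lam + e.*2 :: behead lam.
have lamP' : is_partition lam'.
  rewrite /is_partition /lam'; case: (lam) lamP => [|x s] /= /andP[s_sorted].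
    by rewrite !inE; lia.
  rewrite !inE !negb_or => /andP[_ ->]; rewrite andbT; apply/andP; split; last by lia.
  by case: s s_sorted => //= y s /andP[yx ->]; rewrite andbT; lia.
have nth' j : nth 0 lam' j = nth 0 lam j + (j == 0) * e.*2.
  by rewrite /lam'; case: (lam) j => [|x s] [|j] //=; rewrite ?nth_nil; lia.
pose N := (size lam + size gam).+1 * e.
have le_N m : m <= (size lam + size gam).+1 -> m <= N.
  by move=> /leq_trans; apply; rewrite leq_pmulr.
have lamN : size lam <= N by apply: le_N; lia.
have gamN : size gam <= N by apply: le_N; lia.
have lamN' : size lam' <= N by apply: le_N; rewrite /= size_behead; lia.
have bead' j : bead N lam' j = (j == 0) * 2 * e + bead N lam j.
  by rewrite /bead nth' addnAC addnC -mulnA mul2n.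
have bead_mod j : bead N lam' j %% e = bead N lam j %% e by rewrite bead' modnMDl.
have core' : has_core e lam' gam.
  apply/(has_coreP e_gt0 lamP' lamN' gamC gamN) => i i_lt.
  move/(has_coreP e_gt0 lamP lamN gamC gamN): core => <- //.
  by apply: eq_bigr => j _; rewrite bead_mod.
have [_ _ sum_le _ _] := has_core_rescount e_gt0 core lamP lamN.
have sum' : sumn lam' = sumn lam + 2 * e by rewrite /lam'; case: (lam) => [|x s] /=; lia.
exists lam'; split=> //; first by rewrite sum' -addnBAC // divnDMl // w_eq addn2.
apply: tuple_nth_inj => i i_lt.
have dvd_N : e %| N by rewrite dvdn_mull.
rewrite !(odd_sequence_oddres dvd_N) //; apply: eq_bigr => j _.
by rewrite bead_mod nth' oddD oddM odd_double andbF addbF.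
Qed.

(** The entries add up to the number of odd parts, which has the parity of the size, and the size is
    [sumn gam + w * e] with [e] odd. *)
Lemma oddseqs_parity e gam w theta : odd e -> is_core_partition e gam ->
  oddseqs e gam w theta -> odd w = odd (sumn gam) (+) odd (sumn theta).
Proof.
move=> e_odd gamC; have e_gt0 : 0 < e by case: e e_odd {gamC theta}.
move=> [lam [lamP core w_eq ->]].
pose N := (size lam + size gam) * e.
have lamN : size lam <= N by rewrite (leq_trans (leq_addr (size gam) _)) ?leq_pmulr.
have gamN : size gam <= N by rewrite (leq_trans (leq_addl (size lam) _)) ?leq_pmulr.
have [sum_lam _] := core_weight e_gt0 lamP lamN gamC gamN core.
have odd_lam : odd (sumn lam) = odd (sumn gam) (+) odd w.
  by rewrite -w_eq sum_lam addKn mulnK // oddD oddM e_odd andbT.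
suff -> : odd (sumn (odd_sequence e lam)) = odd (sumn lam).
  by rewrite odd_lam addKb.
rewrite (sumn_nth (N := e)) ?size_tuple //.
have -> : \sum_(i < e) nth 0 (odd_sequence e lam) i = \sum_(j < N) odd (nth 0 lam j).
  transitivity (\sum_(i < e) oddres e N lam i).
    by apply: eq_bigr => i _; rewrite (@odd_sequence_oddres e N) // dvdn_mull.
  rewrite exchange_big; apply: eq_bigr => j _ /=.
  rewrite (bigD1 (Ordinal (ltn_pmod (bead N lam j) e_gt0))) //= eqxx andbT.
  by rewrite big1 ?addn0 // => i; rewrite -val_eqE /= eq_sym => /negbTE->; rewrite andbF.
rewrite (sumn_nth lamN); apply: (big_ind2 (fun x y => odd x = odd y)) => //.
  by move=> x1 x2 y1 y2; rewrite !oddD => -> ->.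
by move=> j _; rewrite oddb.
Qed.

Lemma new_oddseqsE e gam w : odd e -> is_core_partition e gam ->
  new_oddseqs e gam w
  = oddseqs e gam w `\` (if w is w'.+2 then oddseqs e gam w' else set0).
Proof.
move=> e_odd gamC; have e_gt0 : 0 < e by case: e e_odd {gamC}.
apply/seteqP; split=> theta [th_w not_w]; split=> //.
  by case: w th_w not_w => [|[|w]] _ not_w; [case | case | apply: not_w].
move=> w' w'_lt th_w'; have := oddseqs_parity e_odd gamC th_w'.
rewrite -(oddseqs_parity e_odd gamC th_w) => par.
case: w th_w w'_lt par not_w => [|[|w]] // th_w w'_lt par; first by case: w' w'_lt par th_w'.
apply; have le_w : w' <= w.
  move: par w'_lt; have [-> | ] := eqVneq w' w.+1; last by lia.
  by rewrite /=; case: odd.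
have [k ->] : exists k, w = w' + k.*2.
  exists (w - w')./2; have := odd_double_half (w - w').
  by rewrite oddB // par /= negbK addbb; lia.
elim: k => [|k IHk]; first by rewrite addn0.
by rewrite doubleS !addnS; apply: oddseqs_add2.
Qed.

Lemma card_fset_setD (T : choiceType) (A B : set T) : finite_set A -> B `<=` A ->
  #|` fset_set (A `\` B)| + #|` fset_set B| = #|` fset_set A|.
Proof.
move=> finA BA; have finB := sub_finite_set BA finA.
rewrite fset_setD // cardfsD -fset_setI // (setIidr BA) subnK //.
by apply: fsubset_leq_card; rewrite -fset_set_sub.
Qed.

(** Used with [P] the zero-entry condition for [N] and with the full set for [M]. *)
Lemma card_new e gam (P : set (e.-tuple nat)) w : odd e -> is_core_partition e gam ->
  #|` fset_set (new_oddseqs e gam w `&` P)|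
    + (if w is w'.+2 then #|` fset_set (oddseqs e gam w' `&` P)| else 0)
  = #|` fset_set (oddseqs e gam w `&` P)|.
Proof.
move=> e_odd gamC; have e_gt0 : 0 < e by case: e e_odd {gamC P}.
rewrite new_oddseqsE //.
have -> (A B : set (e.-tuple nat)) : (A `\` B) `&` P = (A `&` P) `\` (B `&` P).
  by apply/seteqP; split=> x /=; tauto.
case: w => [|[|w]]; rewrite ?set0I ?setD0 ?addn0 //.
apply: card_fset_setD.
  exact: finite_setIl (finite_oddseqs _ _ e_gt0).
by move=> x [xw Px]; split=> //; apply: oddseqs_add2.
Qed.

Lemma card_oddseqs n gam w : is_core_partition n.*2.+1 gam ->
  Tcount n.*2.+1 gam w = size (comps n.+1 w) /\
  Zcount n.*2.+1 gam w = size (comps n w).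
Proof.
move=> gamC; have [c [size_c c_ge S_eq]] := oddseqs_absets w (ltn0Sn n.*2) gamC.
have E0 : oddseqs n.*2.+1 gam w = absets n.*2.+1 c w false.
  by apply/seteqP; split=> x /S_eq.
have E1 : oddseqs n.*2.+1 gam w `&` has_zero_entry n.*2.+1 = absets n.*2.+1 c w true.
  rewrite E0; apply/seteqP; split=> x /=.
    by move=> [[_ x_ab] x0]; split.
  by move=> [x0 x_ab]; split; [split | apply: x0].
split.
  rewrite /Tcount E0; apply: card_fset_set.
  by have := card_absets false size_c c_ge; rewrite addn1.
rewrite /Zcount E1; apply: card_fset_set.
by have := card_absets true size_c c_ge; rewrite addn0.
Qed.

Local Close Scope classical_set_scope.
Local Open Scope ring_scope.

(** Counting by the first entry gives partial sums, which multiplication by [1 - x] undoes. *)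
Lemma genfun_comps_rec h :
  genfun (fun w => size (comps h.+1 w)) * (1 - fpsX)
  = genfun (fun w => size (comps h w)).
Proof.
rewrite mulrBr mulr1 [_ * fpsX]mulrC; apply/fpsP => w.
transitivity ((size (comps h.+1 w))%:Z
   - fps_coef (fpsX * genfun (fun w => size (comps h.+1 w))) w) => //.
rewrite fps_coefXM; case: w => [|w].
  by rewrite subr0 size_compsS big_ord1.
rewrite -[fps_coef _ _]/((size (comps h.+1 w))%:Z) !size_compsS big_ord_recl subn0.
rewrite (eq_bigr (fun x : 'I_w.+1 => size (comps h (w - x)))) //.
by rewrite PoszD addrK.
Qed.

Lemma genfun_comps h : genfun (fun w => size (comps h w))
  = ((1 + fpsX) * (1 - fpsX) ^+ h.+1)^-1.
Proof.
have U1 := unit_fps_1subX int; have U2 := unit_fps_1addX int.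
have UU k : (1 + fpsX) * (1 - fpsX) ^+ k \is a @GRing.unit (fps int).
  by rewrite unitrM U2 unitrX.
suff H : genfun (fun w => size (comps h w)) * ((1 + fpsX) * (1 - fpsX) ^+ h.+1) = 1.
  by apply: (mulIr (UU h.+1)); rewrite mulVr.
elim: h => [|h IHh]; last by rewrite exprS (mulrCA (1 + fpsX)) (mulrA (genfun _)) genfun_comps_rec.
rewrite expr1 mulrBr mulr1 mulrDl mul1r opprD addrA addrK.
rewrite mulrBr mulr1 mulrC -mulrA.
apply/fpsP => w; transitivity ((size (comps 0 w))%:Z
   - fps_coef (fpsX * (fpsX * genfun (fun w => size (comps 0 w)))) w) => //.
rewrite fps_coefXM; case: w => [|w]; first by rewrite subr0.
rewrite fps_coefXM; case: w => [|w]; first by rewrite subr0.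
rewrite -[fps_coef _ _]/((size (comps 0 w))%:Z) !size_comps0 /=.
by rewrite negbK subrr.
Qed.

Lemma genfun_step2 (a t : nat -> nat) :
    (forall w, a w + (if w is w'.+2 then t w' else 0) = t w)%N ->
  genfun a = genfun t * ((1 + fpsX) * (1 - fpsX)).
Proof.
move=> a_t; have -> : (1 + fpsX) * (1 - fpsX) = 1 - fpsX * fpsX :> fps int.
  by rewrite mulrBr mulr1 mulrDl mul1r opprD addrA addrK.
rewrite mulrBr mulr1 mulrC -mulrA; apply/fpsP => w.
transitivity ((t w)%:Z - fps_coef (fpsX * (fpsX * genfun t)) w) => //.
rewrite fps_coefXM; case: w => [|w]; first by rewrite -a_t addn0 subr0.
rewrite fps_coefXM; case: w => [|w]; first by rewrite -a_t addn0 subr0.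
by rewrite -[fps_coef (genfun t) _]/((t w)%:Z) -(a_t w.+2) PoszD addrK.
Qed.

Lemma counts_genfun n gam : is_core_partition n.*2.+1 gam ->
  [/\ genfun (Ncount n.*2.+1 gam) = ((1 - fpsX) ^+ n)^-1,
      genfun (Mcount n.*2.+1 gam) = ((1 - fpsX) ^+ n.+1)^-1,
      genfun (Zcount n.*2.+1 gam) = ((1 + fpsX) * (1 - fpsX) ^+ n.+1)^-1
    & genfun (Tcount n.*2.+1 gam) = ((1 + fpsX) * (1 - fpsX) ^+ n.+2)^-1].
Proof.
move=> gamC; have e_odd : odd n.*2.+1 by rewrite /= odd_double.
have T_eq : genfun (Tcount n.*2.+1 gam) = ((1 + fpsX) * (1 - fpsX) ^+ n.+2)^-1.
  rewrite -genfun_comps; apply/fpsP => w /=.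
  by have [-> _] := card_oddseqs w gamC.
have Z_eq : genfun (Zcount n.*2.+1 gam) = ((1 + fpsX) * (1 - fpsX) ^+ n.+1)^-1.
  rewrite -genfun_comps; apply/fpsP => w /=.
  by have [_ ->] := card_oddseqs w gamC.
have U1 := unit_fps_1subX int; have U2 := unit_fps_1addX int.
have cancel k : ((1 + fpsX) * (1 - fpsX) ^+ k.+1)^-1 * ((1 + fpsX) * (1 - fpsX))
    = ((1 - fpsX) ^+ k)^-1 :> fps int.
  have Uk : (1 - fpsX) ^+ k \is a @GRing.unit (fps int) by rewrite unitrX.
  have UA : (1 + fpsX) * (1 - fpsX) \is a @GRing.unit (fps int).
    by rewrite unitrM U1 U2.
  by rewrite exprS [X in X^-1 * _]mulrA invrM // -mulrA mulVr ?mulr1.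
split=> //.
  rewrite -cancel -Z_eq; apply: genfun_step2 => w.
  exact: (card_new (has_zero_entry _)).
rewrite -cancel -T_eq; apply: genfun_step2 => w.
have := card_new setT w e_odd gamC; rewrite !setIT /Mcount /Tcount => <-.
by case: w => [|[|w]] //; rewrite setIT.
Qed.

Lemma genfun_inj a b : genfun a = genfun b -> forall w, a w = b w.
Proof. by move/fpsP => eq_ab w; have [] := eq_ab w. Qed.

Theorem theorem6p14 (e : nat) (e_gt1 : (1 < e)%N) (e_odd : odd e) :
  (forall gam : seq nat, is_core_partition e gam ->
    [/\ genfun (Ncount e gam) = ((1 - fpsX) ^+ ((e - 1) %/ 2))^-1,
        genfun (Mcount e gam) = ((1 - fpsX) ^+ ((e + 1) %/ 2))^-1,
        genfun (Zcount e gam) =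
          ((1 + fpsX) * (1 - fpsX) ^+ ((e + 1) %/ 2))^-1
      & genfun (Tcount e gam) =
          ((1 + fpsX) * (1 - fpsX) ^+ ((e + 3) %/ 2))^-1])
  /\
  (forall gam gam' : seq nat,
     is_core_partition e gam -> is_core_partition e gam' ->
     forall w : nat,
     [/\ Ncount e gam w = Ncount e gam' w,
         Mcount e gam w = Mcount e gam' w,
         Zcount e gam w = Zcount e gam' w
       & Tcount e gam w = Tcount e gam' w]).
Proof.
have [n ->] : exists n, e = n.*2.+1.
  by exists e./2; have := odd_double_half e; rewrite e_odd.
split=> [gam gamC | gam gam' gamC gamC' w].
  have [-> -> -> ->] := counts_genfun gamC.
  have -> : ((n.*2.+1 - 1) %/ 2 = n)%N by lia.
  have -> : ((n.*2.+1 + 1) %/ 2 = n.+1)%N by lia.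
  by have -> : ((n.*2.+1 + 3) %/ 2 = n.+2)%N by lia.
have [N_eq M_eq Z_eq T_eq] := counts_genfun gamC.
have [N_eq' M_eq' Z_eq' T_eq'] := counts_genfun gamC'.
by split; apply: genfun_inj; rewrite ?N_eq ?M_eq ?Z_eq ?T_eq.
Qed.
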